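(* Let $P$ be a measurable space, $d\ge1$, $U\subset\mathbb R^d$ a fixed bounded neighborhood of the origin, and let $\mathsf A(p)\subset U$ and $\mathsf A^\infty(p)\subset\mathbb R^d$ ($p\in P$) be families of sets whose graphs $\{(p,s):s\in\mathsf A(p)\}$ and $\{(p,t):t\in\mathsf A^\infty(p)\}$ are measurable in the product $\sigma$-algebra. Fix $\boldsymbol\beta\in(0,\infty)^d$, put $Q:=\sum_i\beta_i$, and let $c:P\to(0,\infty)$ be measurable with $0<c_-\le c(p)\le c_+<\infty$. Let $G:P\times\mathbb R^d\to[0,\infty)$ be measurable and such that, for some $g_+<\infty$, $$G(p,D_u^{\boldsymbol\beta}t)=uG(p,t)\quad(p\in P,\ t\in\mathbb R^d,\ u>0),\qquad \sup_{p\in P}\ \sup_{\rho_{\boldsymbol\beta}(t)=1}G(p,t)\le g_+ .$$ Let $\mu\ge0$. Let $\phi$ (real-valued) and $b$ (complex-valued) be measurable on $\{(p,s):p\in P,\ s\in\mathsf A(p)\}$ with $\phi(p,s)\ge\mu$, let $b_0:P\to\mathbb C$ be bounded and measurable, let $\mathcal K:[0,\infty)\to\mathbb C$ be measurable, and put $$\mathcal I_{\mathcal K}(z,p):=\int_{\mathsf A(p)}b(p,s)\,\mathcal K(z\phi(p,s))\,ds .$$ For $q_z(p):=(zc(p))^{-1}$ define $$E_z(p):=D_{zc(p)}^{\boldsymbol\beta}\mathsf A(p),\qquad X_z(p,t):=z\bigl[\phi(p,D_{q_z(p)}^{\boldsymbol\beta}t)-\mu\bigr].$$ Assume that $b$ is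 uniformly bounded on the graph of $\mathsf A$ and that for every $T<\infty$, as $z\to\infty$, $$\sup_{p\in P}\ \sup_{t\in E_z(p),\ \rho_{\boldsymbol\beta}(t)\le T}\Bigl(|b(p,D_{q_z(p)}^{\boldsymbol\beta}t)-b_0(p)|+|X_z(p,t)-G(p,t)|\Bigr)\longrightarrow0 .$$ Suppose also that for some $\kappa_G>0$ and all sufficiently large $z$, $X_z(p,t)\ge\kappa_G G(p,t)$ for all $p\in P$, $t\in E_z(p)$. Let $\mathcal N_{\mathcal K}(z)>0$ and define $\mathcal K_z(v):=\mathcal K(z\mu+v)/\mathcal N_{\mathcal K}(z)$ for $v\ge0$. Assume that $\mathcal K_z\to\mathcal K_\infty$ locally uniformly on $[0,\infty)$ as $z\to\infty$ for a continuous function $\mathcal K_\infty$, and that for some constants $C<\infty$, $r\ge0$, $\eta>0$, $$|\mathcal K_z(v)|\le C(1+v)^re^{-\eta v},\qquad v\ge0,$$ for all sufficiently large $z$. Assume finally that there exists $\gamma$ with $0<\gamma<\min\{1,\eta\kappa_G,\eta\}$ such that $$\sup_{p\in P}\int_{\mathbb R^d}\bigl|\mathbf 1_{E_z(p)}(t)-\mathbf 1_{\mathsf A^\infty(p)}(t)\bigr|e^{-\gamma G(p,t)}\,dt\longrightarrow0\quad(z\to\infty)$$ and $$\lim_{T\to\infty}\limsup_{z\to\infty}\sup_{p\in P}\int_{E_z(p)\cap\{\rho_{\boldsymbol\beta}>T\}}e^{-\gamma G(p,t)}\,dt=0 .$$ Then the integrals $\mathcal I_{\mathcal K}(z,p)$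 (for all sufficiently large $z$) and $\int_{\mathsf A^\infty(p)}\mathcal K_\infty(G(p,t))\,dt$ are absolutely convergent, and $$\sup_{p\in P}\left|\frac{(zc(p))^Q}{\mathcal N_{\mathcal K}(z)}\mathcal I_{\mathcal K}(z,p)-b_0(p)\int_{\mathsf A^\infty(p)}\mathcal K_\infty(G(p,t))\,dt\right|\longrightarrow0\qquad(z\to\infty).$$ If moreover $P$ is equipped with a finite measure $\nu$, then the coefficient below is absolutely integrable and $$\int_P\mathcal I_{\mathcal K}(z,p)\,d\nu(p)=\mathcal N_{\mathcal K}(z)z^{-Q}\left[\int_Pc(p)^{-Q}b_0(p)\left(\int_{\mathsf A^\infty(p)}\mathcal K_\infty(G(p,t))\,dt\right)d\nu(p)+o(1)\right].$$
   Context: For $\boldsymbol\beta=(\beta_1,\dots,\beta_d)\in(0,\infty)^d$ and $u>0$, the anisotropic dilation is $D_u^{\boldsymbol\beta}t:=(u^{\beta_1}t_1,\dots,u^{\beta_d}t_d)$. The weighted gauge $\rho_{\boldsymbol\beta}$ on $\mathbb R^d$ is: $\rho_{\boldsymbol\beta}(0)=0$ and, for $t\ne0$, $\rho_{\boldsymbol\beta}(t)$ is the unique $r>0$ with $|D_{1/r}^{\boldsymbol\beta}t|=1$ (Euclidean norm). Integrals over subsets of $\mathbb R^d$ are with respect to Lebesgue measure; $\mathbf 1_E$ is the indicator of $E$; suprema over an empty set are zero. *)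

(* Defs.v *)
From HB Require Import structures.
From mathcomp Require Import all_boot all_order all_algebra.
From mathcomp Require Import all_classical all_reals all_analysis.
From mathcomp Require Import complex.

Set Implicit Arguments.
Unset Strict Implicit.
Unset Printing Implicit Defensive.

Import Order.TTheory GRing.Theory Num.Theory.
Import numFieldTopology.Exports numFieldNormedType.Exports.

Local Open Scope classical_set_scope.
Local Open Scope ring_scope.

(* 'rV[T]_n carries the sigma-algebra generated by the n coordinate maps, as
   n.-tuple T does in the library; on 'rV[R]_n this is the Borel sigma-algebra
   of R^n. *)
Definition measure_rV_display : measure_display -> measure_display.
Proof. exact. Qed.

Section measurable_rV.
Context {d} {T : measurableType d} (n : nat).

Let coor (i : 'I_n) (v : 'rV[T]_n) : T := v ord0 i.

Let rV_set0 : g_sigma_preimage coor set0.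
Proof. exact: sigma_algebra0. Qed.

Let rV_setC A : g_sigma_preimage coor A -> g_sigma_preimage coor (~` A).
Proof. exact: sigma_algebraC. Qed.

Let rV_bigcup (F : _^nat) : (forall i, g_sigma_preimage coor (F i)) ->
  g_sigma_preimage coor (\bigcup_i (F i)).
Proof. exact: sigma_algebra_bigcup. Qed.

HB.instance Definition _ := @isMeasurable.Build (measure_rV_display d)
  'rV[T]_n (g_sigma_preimage coor) rV_set0 rV_setC rV_bigcup.

End measurable_rV.

Lemma measurable_coord d (T : measurableType d) n (i : 'I_n) :
  measurable_fun [set: 'rV[T]_n] (fun v : 'rV[T]_n => v ord0 i).
Proof.
move=> _ Y mY; rewrite setTI; apply: sub_sigma_algebra => /=.
rewrite -bigcup_seq/=; exists i => /=; first by rewrite mem_index_enum.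
by exists Y => //; rewrite setTI.
Qed.

Lemma measurable_fun_rV d1 d2 (T1 : measurableType d1) (T2 : measurableType d2)
    n (f : T1 -> 'rV[T2]_n) :
  (forall i, measurable_fun [set: T1] (fun x => f x ord0 i)) ->
  measurable_fun [set: T1] f.
Proof.
move=> mf.
have H : g_sigma_preimage (fun i => (fun v : 'rV[T2]_n => v ord0 i) \o f)
    `<=` measurable.
  apply: smallest_sub; first exact: sigma_algebra_measurable.
  case: n => [|n] in f mf *; first by rewrite big_ord0.
  rewrite -bigcup_mkord_ord; apply: bigcup_sub => i Ii.
  by move=> A [B mB <-]; exact: mf.
move=> _ A mA; apply: H.
by rewrite g_sigma_preimage_comp; exists A.
Qed.

Section lebesgue_rV.
Context {R : realType}.
Implicit Types n : nat.

Definition rV_cons n (xv : measurableTypeR R * 'rV[R]_n) : 'rV[R]_n.+1 :=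
  row_mx (xv.1)%:M xv.2.

Definition rV_uncons n (v : 'rV[R]_n.+1) : measurableTypeR R * 'rV[R]_n :=
  (v ord0 ord0, \row_j v ord0 (lift ord0 j)).

Lemma rV_cons0 n xv : @rV_cons n xv ord0 ord0 = xv.1.
Proof.
rewrite /rV_cons (_ : ord0 = lshift n (ord0 : 'I_1)); last exact/val_inj.
by rewrite (row_mxEl (xv.1)%:M) mxE eqxx mulr1n.
Qed.

Lemma rV_consS n xv (j : 'I_n) : rV_cons xv ord0 (lift ord0 j) = xv.2 ord0 j.
Proof.
rewrite /rV_cons (_ : lift ord0 j = rshift 1 j); last exact/val_inj.
by rewrite (row_mxEr (xv.1)%:M).
Qed.

Lemma rV_consK n : cancel (@rV_cons n) (@rV_uncons n).
Proof.
move=> -[x v]; rewrite /rV_uncons rV_cons0; congr pair.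
by apply/rowP => j; rewrite mxE rV_consS.
Qed.

Lemma measurable_rV_cons n : measurable_fun setT (@rV_cons n).
Proof.
apply: measurable_fun_rV => i; case: (unliftP ord0 i) => [j ->|->].
- rewrite (_ : (fun _ => _) = (fun v : 'rV[R]_n => v ord0 j) \o snd).
    by apply: measurableT_comp => //; exact: measurable_coord.
  by apply/funext => xv /=; rewrite rV_consS.
- rewrite (_ : (fun _ => _) = fst); first exact: measurable_fst.
  by apply/funext => xv; rewrite rV_cons0.
Qed.

Lemma measurable_rV_uncons n : measurable_fun setT (@rV_uncons n).
Proof.
apply: measurable_fun_pair; first exact: measurable_coord.
apply: measurable_fun_rV => i.
rewrite (_ : (fun _ => _) = (fun v : 'rV[R]_n.+1 => v ord0 (lift ord0 i))).
  exact: measurable_coord.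
by apply/funext => v; rewrite mxE.
Qed.

Section step.
Variables (n : nat) (m : {sigma_finite_measure set 'rV[R]_n -> \bar R}).

Definition lebesgue_rV_step : set 'rV[R]_n.+1 -> \bar R :=
  pushforward (lebesgue_measure \x m)%E (@rV_cons n).

Let step0 : lebesgue_rV_step set0 = 0%E.
Proof. by rewrite /lebesgue_rV_step /pushforward preimage_set0 measure0. Qed.

Let step_ge0 A : (0 <= lebesgue_rV_step A)%E.
Proof. by rewrite /lebesgue_rV_step /pushforward; exact: (measure_ge0 (lebesgue_measure \x m)%E). Qed.

Let step_sigma_additive : semi_sigma_additive lebesgue_rV_step.
Proof.
have mc B : measurable B -> measurable (@rV_cons n @^-1` B).
  by move=> mB; rewrite -[X in measurable X]setTI; exact: measurable_rV_cons.
move=> F mF tF mUF; rewrite /lebesgue_rV_step /pushforward preimage_bigcup.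
apply: measure_semi_sigma_additive.
- by move=> k; exact: mc.
- apply/trivIsetP => /= i j _ _ ij; rewrite -preimage_setI.
  by move/trivIsetP : tF => /(_ _ _ _ _ ij) ->//; rewrite preimage_set0.
- by rewrite -preimage_bigcup; exact: mc.
Qed.

HB.instance Definition _ := isMeasure.Build _ _ _ lebesgue_rV_step
  step0 step_ge0 step_sigma_additive.

Let step_sigma_finite : sigma_finite setT lebesgue_rV_step.
Proof.
have /sigma_finiteP[F [FT ndF Foo]] := sigma_finiteT (@lebesgue_measure R).
have /sigma_finiteP[G [GT ndG Goo]] := sigma_finiteT m.
exists (fun k => @rV_uncons n @^-1` (F k `*` G k)).
  apply/esym; rewrite -subTset => v _.
  have [i _ Fi] : (\bigcup_i F i) (v ord0 ord0) by rewrite -FT.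
  have [j _ Gj] : (\bigcup_i G i) (rV_uncons v).2 by rewrite -GT.
  exists (maxn i j) => //; split.
  - by move: Fi; exact/subsetPset/ndF/leq_maxl.
  - by move: Gj; exact/subsetPset/ndG/leq_maxr.
move=> k; have [mF Fk] := Foo k; have [mG Gk] := Goo k; split.
  rewrite -[X in measurable X]setTI; apply: measurable_rV_uncons => //.
  exact: measurableX.
rewrite /lebesgue_rV_step /pushforward -comp_preimage.
rewrite (_ : _ \o _ = id) ?preimage_id; last exact/funext/rV_consK.
by rewrite product_measure1E// lte_mul_pinfty// ge0_fin_numE.
Qed.

HB.instance Definition _ := Measure_isSigmaFinite.Build _ _ _ lebesgue_rV_step
  step_sigma_finite.

End step.

(* Lebesgue measure on R^n as the n-fold product of lebesgue_measure; on the
   one-point space R^0 it is the unit mass. *)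
Fixpoint lebesgue_rV n : {sigma_finite_measure set 'rV[R]_n -> \bar R} :=
  match n with
  | 0 => \d_(0 : 'rV[R]_0)
  | n'.+1 => lebesgue_rV_step (lebesgue_rV n')
  end.

Lemma lebesgue_rV_box n (A : 'I_n -> set R) :
  (forall i, measurable (A i)) ->
  lebesgue_rV n [set v | forall i, A i (v ord0 i)] =
  (\prod_(i < n) lebesgue_measure (A i))%E.
Proof.
elim: n A => [|n IH] A mA.
  by rewrite big_ord0 /= diracE mem_set//= => -[].
rewrite big_ord_recl -IH//= /lebesgue_rV_step /pushforward.
rewrite -product_measure1E//.
- congr (_ _); apply/seteqP; split => -[x v] /=.
  + move=> H; split=> [|i] /=; first by have := H ord0; rewrite rV_cons0.
    by have := H (lift ord0 i); rewrite rV_consS.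
  + move=> [/= Ax Av] i; case: (unliftP ord0 i) => [j ->|->].
      by rewrite rV_consS; exact: Av.
    by rewrite rV_cons0.
- exact: mA.
- rewrite (_ : (fun _ => _) = \bigcap_(i in [set: 'I_n])
    ((fun v : 'rV[R]_n => v ord0 i) @^-1` A (lift ord0 i))).
    apply: fin_bigcap_measurable => // i _.
    by rewrite -[X in measurable X]setTI; exact: measurable_coord.
  by apply/seteqP; split => v /= H i => [_|]; exact: H.
Qed.

End lebesgue_rV.

Section anisotropic.
Context {R : realType} {d : nat}.
Implicit Types (beta : 'I_d -> R) (t : 'rV[R]_d).

(* The library norm on 'rV[R]_d is the sup norm. *)
Definition euclidean_norm t : R := Num.sqrt (\sum_i t ord0 i ^+ 2).

Definition dilation beta (u : R) t : 'rV[R]_d :=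
  \row_i (u `^ beta i * t ord0 i).

(* For t <> 0 and beta > 0 such an r exists and is unique, so xget picks it. *)
Definition weighted_gauge beta t : R :=
  if t == 0 then 0
  else xget 0 [set r : R | 0 < r /\ euclidean_norm (dilation beta r^-1 t) = 1].

End anisotropic.

(* Supremum of a nonnegative family, equal to 0 (and not -oo) when D is empty. *)
Definition nnsup {R : realType} {T : Type} (D : set T) (f : T -> \bar R) :
  \bar R := ereal_sup (0%E |` f @` D).

Section complex_integral.
Context d (T : measurableType d) (R : realType).
Implicit Types (mu : {measure set T -> \bar R}) (D : set T) (f : T -> R[i]).

Definition cmeasurable_fun D f :=
  measurable_fun D (fun x => complex.Re (f x)) /\
  measurable_fun D (fun x => complex.Im (f x)).

Definition cintegrable mu D f :=
  cmeasurable_fun D f /\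
  (\int[mu]_(x in D) (Normc.normc (f x))%:E < +oo)%E.

Definition cintegral mu D f : R[i] :=
  ((\int[mu]_(x in D) complex.Re (f x)) +i*
   (\int[mu]_(x in D) complex.Im (f x)))%C.

End complex_integral.

Section kernel.
Context {R : realType} {d : nat} {P : Type}.
Variables (beta : 'I_d -> R) (c : P -> R).
Implicit Types (A : P -> set 'rV[R]_d) (phi : P -> 'rV[R]_d -> R) (z : R).

(* With q_z(p) = (z c(p))^-1: rescaled_set, unscale and rescaled_phase are
   E_z(p), t |-> D_{q_z(p)} t and X_z(p, t). *)
Definition rescaled_set A z p : set 'rV[R]_d :=
  dilation beta (z * c p) @` A p.

Definition unscale z p t : 'rV[R]_d := dilation beta (z * c p)^-1 t.

Definition rescaled_phase phi (mu : R) z p t : R :=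
  z * (phi p (unscale z p t) - mu).

Definition kernel_integral A phi (b : P -> 'rV[R]_d -> R[i]) (K : R -> R[i])
    z p : R[i] :=
  cintegral (lebesgue_rV d) (A p) (fun s => b p s * K (z * phi p s)).

Definition rescaled_kernel (K : R -> R[i]) (NK : R -> R) (mu z v : R) : R[i] :=
  K (z * mu + v) / ((NK z)%:C)%C.

End kernel.

(* f z --> g as z --> +oo: every v0 >= 0 has a neighborhood in [0, +oo[ on which
   the convergence is uniform. *)
Definition locally_uniform_cvg {R : realType} (f : R -> R -> R[i])
    (g : R -> R[i]) :=
  forall v0 : R, 0 <= v0 -> exists2 V : set R, nbhs v0 V &
    nnsup (V `&` `[0, +oo[) (fun v => (Normc.normc (f z v - g v))%:E)
      @[z --> +oo] --> 0%E.

(* Main.v *)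
(* Substituting s = D_{1/(z c(p))} t turns (z c(p))^Q I(z,p) / N(z) into the
   integral over E_z(p) of b K_z(X_z). With w = exp(-gamma G), both integrands
   are dominated by a multiple of w: on E_z(p) because X_z >= kappa G and K_z
   decays at every rate below eta, and in the limit by passing to the limit in
   K_z. On {rho <= T} the integrands differ by at most eps w, since there G is
   bounded and K_z converges uniformly on segments; the remaining part of
   E_z(p) is a w-tail, and the mismatch of the domains is a w-mass of the
   symmetric difference. The averaged statement is the uniform one integrated
   against a finite measure. *)

Require Import Defs.
From HB Require Import structures.
From mathcomp Require Import all_boot all_order all_algebra.
From mathcomp Require Import all_classical all_reals all_analysis.
From mathcomp Require Import complex measurable_realfun ring lra.

Set Implicit Arguments.
Unset Strict Implicit.
Unset Printing Implicit Defensive.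

Import Order.TTheory GRing.Theory Num.Theory.
Import numFieldTopology.Exports numFieldNormedType.Exports.

Local Open Scope classical_set_scope.
Local Open Scope ring_scope.

(** * Anisotropic dilations and Lebesgue measure *)

(** The mass of [w] over the whole space may be infinite, since [G] is allowed to vanish off the
    origin. Its finiteness over the relevant sets, uniformly in [p], is taken from one fixed scale
    [z0]: there [E z0 p] is a dilate of a subset of the bounded set [U], with volume controlled
    through [cplus]. The weighted symmetric difference then carries the bound to [Ainf p], and from
    there to [E z p] for every large [z]. The kernels are compared at two different arguments, [X_z]
    and [G]. Uniform convergence on segments therefore has to be combined with continuity of [Kinf],
    and a single compactness argument does both. Complex integrals are compared through real and
    imaginary parts, which costs the factor [2] that the final constants absorb. All error sources
    are put into one pointwise majorant, so that integrals over different domains are compared only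
    once. Since Lebesgue measure is an iterated product, the Jacobian of a dilation is obtained by
    induction on the dimension. *)

Section dilation_lemmas.
Context {R : realType} {d : nat}.
Implicit Types (beta : 'I_d -> R) (t : 'rV[R]_d) (u v : R).

Lemma dilationM beta u v t : 0 <= u -> 0 <= v ->
  dilation beta u (dilation beta v t) = dilation beta (u * v) t.
Proof. by move=> u0 v0; apply/rowP => i; rewrite !mxE powRM// mulrA. Qed.

Lemma dilation1 beta t : dilation beta 1 t = t.
Proof. by apply/rowP => i; rewrite !mxE powR1 mul1r. Qed.

Lemma dilationK beta u : 0 < u -> cancel (dilation beta u) (dilation beta u^-1).
Proof.
move=> u0 t.
by rewrite dilationM ?invr_ge0 ?(ltW u0)// mulVf ?gt_eqF// dilation1.
Qed.

Lemma dilationVK beta u : 0 < u -> cancel (dilation beta u^-1) (dilation beta u).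
Proof.
by move=> u0; rewrite -{2}(invrK u); apply: dilationK; rewrite invr_gt0.
Qed.

Lemma dilation_image beta u (A : set 'rV[R]_d) : 0 < u ->
  dilation beta u @` A = dilation beta u^-1 @^-1` A.
Proof.
move=> u0; apply/seteqP; split => [_ [s As <-]|t /= At] /=.
  by rewrite dilationK.
by exists (dilation beta u^-1 t) => //; rewrite dilationVK.
Qed.

Lemma dilation_eq0 beta u t : 0 < u -> (dilation beta u t == 0) = (t == 0).
Proof.
move=> u0; apply/eqP/eqP => [E|->]; last first.
  by apply/rowP => i; rewrite !mxE mulr0.
by rewrite -(dilationK beta u0 t) E; apply/rowP => i; rewrite !mxE mulr0.
Qed.

Lemma measurable_fun_dilation d' (T : measurableType d') beta (f : T -> R)
    (g : T -> 'rV[R]_d) : measurable_fun setT f -> measurable_fun setT g ->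
  measurable_fun setT (fun x => dilation beta (f x) (g x)).
Proof.
move=> mf mg; apply: measurable_fun_rV => i.
rewrite (_ : (fun _ => _) = (fun x => f x `^ beta i * g x ord0 i)); last first.
  by apply/funext => x; rewrite mxE.
apply: measurable_funM.
  exact: (measurableT_comp (measurable_powR (beta i)) mf).
exact: (measurableT_comp (measurable_coord i) mg).
Qed.

Lemma measurable_dilation beta u : measurable_fun setT (dilation beta u).
Proof. exact: (@measurable_fun_dilation _ _ _ (cst u) id). Qed.

End dilation_lemmas.

Section dilation_integral.
Context {R : realType}.
Local Open Scope ereal_scope.

(** The right-hand side is itself a measure in [A]: a scaled pushforward. By uniqueness of Lebesgue
    measure it is enough to compare the two on half-open intervals. *)
Lemma lebesgue_measure_mul (a : R) (A : set R) : (0 < a)%R -> measurable A ->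
  lebesgue_measure A =
  a%:E * lebesgue_measure ((fun x => a * x)%R @^-1` A).
Proof.
move=> a0 mA.
have mm : measurable_fun setT (fun x => a * x : measurableTypeR R)%R.
  exact: measurable_funM.
pose a' := NngNum (ltW a0).
pose nu' : {measure set (measurableTypeR R) -> \bar R} :=
  mscale a' (pushforward lebesgue_measure (fun x => a * x : measurableTypeR R)%R).
pose nu := nu' mm.
suff: lebesgue_measure A = nu A by [].
apply: lebesgue_measure_unique => //= _ [[x y]] _ <-.
have -> : nu `](x, y).1, (x, y).2]%classic =
    a%:E * lebesgue_measure (`](x / a)%R, (y / a)%R]%classic : set R).
  rewrite /nu /nu' /= /mscale /pushforward; congr (_ * lebesgue_measure _).
  apply/seteqP; split => z /=; rewrite !in_itv/= => /andP[xz zy];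
    move: xz zy; rewrite ltr_pdivrMr// ler_pdivlMr// ![(z * a)%R]mulrC => -> ->//.
rewrite !lebesgue_measure_itv/= !lte_fin ltr_pM2r ?invr_gt0//.
case: ifPn => _; last by rewrite mule0.
by rewrite -!EFinD -EFinM -mulrBl mulrCA divff ?mulr1// gt_eqF.
Qed.

Lemma ge0_integral_lebesgue_mul (a : R) (f : R -> \bar R) : (0 < a)%R ->
  measurable_fun setT f -> (forall x, 0 <= f x) ->
  \int[lebesgue_measure]_x f x =
  a%:E * \int[lebesgue_measure]_x f (a * x)%R.
Proof.
move=> a0 mf f0.
have mm : measurable_fun setT (fun x => a * x : measurableTypeR R)%R.
  exact: measurable_funM.
pose a' := NngNum (ltW a0).
pose nu' : {measure set (measurableTypeR R) -> \bar R} :=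
  mscale a' (pushforward lebesgue_measure (fun x => a * x : measurableTypeR R)%R).
pose nu := nu' mm.
transitivity (\int[nu]_x f x).
  apply: eq_measure_integral => /= A mA _.
  by rewrite /mscale/= /pushforward -lebesgue_measure_mul.
rewrite /nu /nu' ge0_integral_mscale//= ge0_integral_pushforward//.
Qed.

Lemma ge0_integral_rVS n (f : 'rV[R]_n.+1 -> \bar R) :
  measurable_fun setT f -> (forall t, 0 <= f t) ->
  \int[lebesgue_rV n.+1]_t f t =
  \int[lebesgue_measure]_x \int[lebesgue_rV n]_v f (rV_cons (x, v)).
Proof.
move=> mf f0; rewrite /= /lebesgue_rV_step.
rewrite ge0_integral_pushforward//; last exact: measurable_rV_cons.
rewrite (fubini_tonelli1 (f \o @rV_cons R n))//.
  exact: (measurableT_comp mf (@measurable_rV_cons R n)).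
by move=> x; exact: f0.
Qed.

(** Induction on [n]: Tonelli separates the first coordinate, on which the dilation is
    multiplication by [u] to the power [beta ord0]. On the others it is the dilation with the
    shifted exponents, and the two Jacobians multiply. *)
Lemma ge0_integral_dilation n (beta : 'I_n -> R) (u : R)
    (f : 'rV[R]_n -> \bar R) : (0 < u)%R ->
  measurable_fun setT f -> (forall t, 0 <= f t) ->
  \int[lebesgue_rV n]_t f t =
  (u `^ \sum_i beta i)%:E * \int[lebesgue_rV n]_t f (dilation beta u t).
Proof.
elim: n beta f => [|n IH] beta f u0 mf f0.
  rewrite big_ord0 powRr0 mul1e; apply: eq_integral => t _; congr (f _).
  by apply/rowP => -[].
have mfD := measurableT_comp mf (measurable_dilation beta u).
rewrite (ge0_integral_rVS mf f0) (ge0_integral_rVS mfD (fun t => f0 _))/=.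
have mF (g : 'rV[R]_n.+1 -> \bar R) : measurable_fun setT g ->
    measurable_fun setT (g \o @rV_cons R n).
  by move=> mg; exact: (measurableT_comp mg (@measurable_rV_cons R n)).
have mF2 (g : 'rV[R]_n.+1 -> \bar R) (x : measurableTypeR R) : measurable_fun setT g ->
    measurable_fun setT (fun v => g (rV_cons (x, v))).
  move=> /mF mg; exact: (measurableT_comp mg (pair1_measurable x)).
pose gamma i := beta (lift ord0 i).
have Dcons x v : dilation beta u (rV_cons (x, v)) =
    rV_cons (u `^ beta ord0 * x, dilation gamma u v)%R.
  apply/rowP => i; rewrite mxE; case: (unliftP ord0 i) => [j ->|->].
    by rewrite !rV_consS/= mxE.
  by rewrite !rV_cons0.
have ub0 : (0 < u `^ beta ord0)%R by exact: powR_gt0.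
have mI : measurable_fun setT
    (fun x : measurableTypeR R => \int[lebesgue_rV n]_v f (rV_cons (x, v))).
  apply: (measurable_fun_fubini_tonelli_F (f \o @rV_cons R n)) => //.
  - exact: mF.
  - by move=> x; exact: f0.
rewrite (ge0_integral_lebesgue_mul ub0)//; last first.
  by move=> x; apply: integral_ge0.
rewrite big_ord_recl powRD; last by rewrite (gt_eqF u0) implybT.
rewrite EFinM -muleA; congr (_ * _).
rewrite -ge0_integralZl//; last 3 first.
- apply: (measurable_fun_fubini_tonelli_F
    ((f \o dilation beta u) \o @rV_cons R n)) => //.
  + exact: mF.
  + by move=> x; exact: f0.
- by move=> x _; apply: integral_ge0 => v _; exact: f0.
- by rewrite lee_fin powR_ge0.
apply: eq_integral => x _; rewrite (IH gamma)//; last exact: mF2.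
by congr (_ * _); apply: eq_integral => v _ /=; rewrite Dcons.
Qed.

End dilation_integral.

(** * The weighted gauge *)

Section weighted_gauge_lemmas.
Context {R : realType} {d : nat} (beta : 'I_d -> R).
Hypothesis beta_gt0 : forall i, 0 < beta i.
Implicit Types t : 'rV[R]_d.

Let sqn t : R := \sum_i t ord0 i ^+ 2.

Let euclidean_norm1 t : euclidean_norm t = 1 <-> sqn t = 1.
Proof.
have s0 : 0 <= sqn t by apply: sumr_ge0 => i _; exact: sqr_ge0.
rewrite /euclidean_norm -/(sqn t); split => [E|->]; last by rewrite sqrtr1.
by rewrite -(sqr_sqrtr s0) E expr1n.
Qed.

(** Every term is monotone in the scale, and one with a nonzero coordinate is strictly so. This
    strictness is what makes the gauge radius unique. *)
Let sqn_dilation_lt u v t : t != 0 -> 0 < u -> u < v ->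
  sqn (dilation beta u t) < sqn (dilation beta v t).
Proof.
move=> t0 u0 uv.
have v0 : 0 < v by exact: lt_trans uv.
have [i ti0] : exists i, t ord0 i != 0.
  apply/existsP; apply: contraNT t0 => /existsPn H; apply/eqP/rowP => i.
  by rewrite mxE; apply/eqP; move: (H i); rewrite negbK.
rewrite /sqn (bigD1 i)//= [ltRHS](bigD1 i)//=.
apply: ltr_leD.
  rewrite !mxE !exprMn ltr_pM2r ?exprn_even_gt0// ltr_pXn2r// ?nnegrE ?powR_ge0//.
  by rewrite gt0_ltr_powR// nnegrE ltW.
apply: ler_sum => j _; rewrite !mxE !exprMn ler_wpM2r ?sqr_ge0//.
rewrite lerXn2r// ?nnegrE ?powR_ge0//.
by rewrite ge0_ler_powR// ?nnegrE ltW.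
Qed.

Let gauge_exists t : t != 0 ->
  exists2 r : R, 0 < r & sqn (dilation beta r^-1 t) = 1.
Proof.
move=> t0.
have [i ti0] : exists i, t ord0 i != 0.
  apply/existsP; apply: contraNT t0 => /existsPn H; apply/eqP/rowP => i.
  by rewrite mxE; apply/eqP; move: (H i); rewrite negbK.
have d0 : (0 < d)%N by rewrite (leq_ltn_trans _ (ltn_ord i)).
have d0R : 0 < d%:R :> R by rewrite ltr0n.
(* With the scale written as [expR s], the squared norm becomes a continuous function on the whole
   line, and the intermediate value theorem applies. *)
pose f (s : R) : R := \sum_j (expR (beta j * s) * t ord0 j) ^+ 2.
have fE s : sqn (dilation beta (expR s) t) = f s.
  apply: eq_bigr => j _; rewrite mxE; congr ((_ * _) ^+ 2).
  by rewrite -expRM mulrC.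
have fc : continuous f.
  move=> s; apply: cvg_big => [|j _]; first exact: add_continuous.
  have ec : expR (beta j * x) @[x --> s] --> expR (beta j * s).
    apply: (@continuous_comp _ _ _ ( *%R (beta j)) expR).
      exact: mulrl_continuous.
    exact: continuous_expR.
  by apply: cvgM; apply: cvgM => //; exact: cvg_cst.
(* Both endpoints come from [1 + x <= expR x]. At [- a] each coordinate has modulus at most [1 / d],
   so the squares sum to at most [1 / d <= 1]; at [b] the [i]-th coordinate alone has modulus at
   least [1]. *)
pose a : R := \sum_j d%:R * `|t ord0 j| / beta j.
have a0 : 0 <= a.
  by apply: sumr_ge0 => j _; rewrite divr_ge0 ?mulr_ge0// ltW.
pose b : R := `|t ord0 i|^-1 / beta i.
have b0 : 0 <= b by rewrite divr_ge0// ltW.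
have fa : f (- a) <= 1.
  apply: (@le_trans _ _ (\sum_(j < d) d%:R ^- 2)).
    apply: ler_sum => j _; rewrite -exprVn -[leLHS]real_normK ?num_real// lerXn2r// ?nnegrE ?invr_ge0//.
    rewrite normrM ger0_norm ?expR_ge0// mulrN expRN mulrC ler_pdivrMr ?expR_gt0//.
    rewrite mulrC ler_pdivlMr// mulrC.
    apply: le_trans (expR_ge1Dx _); rewrite -[leLHS]add0r lerD//.
    rewrite [leRHS]mulrC -ler_pdivrMr// /a (bigD1 j)//= lerDl.
    by apply: sumr_ge0 => k _; rewrite divr_ge0 ?mulr_ge0// ltW.
  rewrite sumr_const card_ord -[leLHS]mulr_natl expr2 invfM mulrA divff ?gt_eqF// mul1r.
  by rewrite invf_le1// ler1n.
have fb : 1 <= f b.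
  rewrite /f (bigD1 i)//=.
  rewrite -[leLHS]addr0 lerD//; last by apply: sumr_ge0 => k _; exact: sqr_ge0.
  rewrite -[leRHS]real_normK ?num_real// -[leLHS](expr1n _ 2) lerXn2r// ?nnegrE//.
  rewrite normrM ger0_norm ?expR_ge0// -ler_pdivrMr ?normr_gt0// mul1r.
  rewrite /b mulrC divfK ?gt_eqF//.
  by apply: le_trans (expR_ge1Dx _); rewrite lerDr.
have [|||s _ fs] := @IVT R f (- a) b 1.
- by rewrite (le_trans _ b0)// oppr_le0.
- exact: continuous_subspaceT.
- by rewrite ge_min le_max fa fb orbT.
exists (expR (- s)); first exact: expR_gt0.
by rewrite -expRN opprK fE.
Qed.

Lemma weighted_gauge0 : weighted_gauge beta 0 = 0.
Proof. by rewrite /weighted_gauge eqxx. Qed.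

Lemma weighted_gaugeP t : t != 0 -> 0 < weighted_gauge beta t /\
  euclidean_norm (dilation beta (weighted_gauge beta t)^-1 t) = 1.
Proof.
move=> t0; rewrite /weighted_gauge (negbTE t0).
case: xgetP => [r -> //|H].
have [r r0 rE] := gauge_exists t0.
by exfalso; apply: (H r); split => //; exact/euclidean_norm1.
Qed.

Lemma weighted_gauge_unique t r : t != 0 -> 0 < r ->
  euclidean_norm (dilation beta r^-1 t) = 1 -> weighted_gauge beta t = r.
Proof.
move=> t0 r0 /euclidean_norm1 rE.
have [g0 /euclidean_norm1 gE] := weighted_gaugeP t0.
have lt_gr x y : 0 < x -> 0 < y -> sqn (dilation beta x^-1 t) = 1 ->
    sqn (dilation beta y^-1 t) = 1 -> ~~ (x < y).
  move=> x0 y0 xE yE; apply/negP => xy.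
  have := @sqn_dilation_lt y^-1 x^-1 t t0.
  by rewrite invr_gt0 ltf_pV2// xE yE ltxx => /(_ y0 xy).
by apply/eqP; rewrite eq_le !leNgt !lt_gr.
Qed.

(** This replaces the gauge, defined by a choice of root, by an explicit inequality in the
    coordinates, from which measurability can be read off. *)
Lemma weighted_gauge_gt (T : R) t : 0 < T ->
  (T < weighted_gauge beta t) = (1 < \sum_i (dilation beta T^-1 t) ord0 i ^+ 2).
Proof.
move=> T0; rewrite -/(sqn _).
have [->|t0] := eqVneq t 0.
  rewrite weighted_gauge0 ltNge (ltW T0)/=; apply/esym/negbTE; rewrite -leNgt.
  by rewrite /sqn big1// => i _; rewrite !mxE mulr0 expr0n.
have [g0 /euclidean_norm1 gE] := weighted_gaugeP t0.
have [Tg|gT|->] := ltgtP T (weighted_gauge beta t); last by rewrite gE ltxx.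
- apply/esym; rewrite -gE; apply: sqn_dilation_lt => //; first by rewrite invr_gt0.
  by rewrite ltf_pV2.
- apply/esym/negbTE; rewrite -leNgt -gE ltW//; apply: sqn_dilation_lt => //.
    by rewrite invr_gt0.
  by rewrite ltf_pV2.
Qed.

Lemma measurable_weighted_gauge_gt (T : R) : 0 < T ->
  measurable [set t | T < weighted_gauge beta t].
Proof.
move=> T0.
have mf : measurable_fun setT (fun t => sqn (dilation beta T^-1 t)).
  apply: (@measurable_sum _ _ _ _ _ _ (fun i t => (dilation beta T^-1 t) ord0 i ^+ 2)) => i.
  apply: measurable_funX.
  apply: (measurableT_comp (measurable_coord i)); exact: measurable_dilation.
rewrite (_ : [set t | _] = (fun t => sqn (dilation beta T^-1 t)) @^-1` `]1, +oo[).
  by rewrite -[X in measurable X]setTI; exact: mf.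
by apply/seteqP; split => t /=; rewrite in_itv/= andbT weighted_gauge_gt.
Qed.

(** A nonzero [t] is the dilation by its gauge of a point of gauge [1], so homogeneity reduces the
    bound to the unit gauge sphere. *)
Lemma homogeneous_le_gauge (G : 'rV[R]_d -> R) (g T : R) t :
  (forall t, 0 <= G t) ->
  (forall t u, 0 < u -> G (dilation beta u t) = u * G t) ->
  (forall t, weighted_gauge beta t = 1 -> G t <= g) -> 0 <= g ->
  0 <= T -> weighted_gauge beta t <= T -> G t <= g * T.
Proof.
move=> G0 Ghom Gg g0 T0 tT.
have [t0|t0] := eqVneq t 0.
  (* The origin is fixed by all dilations, so homogeneity at scale [2] forces [G 0 = 0]. *)
  have : G (dilation beta 2 t) = 2 * G t by exact: Ghom.
  rewrite (_ : dilation beta 2 t = t) => [E|]; last first.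
    by apply/rowP => i; rewrite t0 !mxE mulr0.
  have -> : G t = 0 by lra.
  exact: mulr_ge0.
have [r0 rE] := weighted_gaugeP t0.
rewrite -(dilationVK beta r0 t) Ghom// mulrC ler_pM ?(ltW r0)//.
apply: Gg; apply: weighted_gauge_unique => //.
  by rewrite dilation_eq0// invr_gt0.
by rewrite invr1 dilation1.
Qed.

End weighted_gauge_lemmas.

(** [U] is not assumed measurable, hence a single [V] that serves all its measurable subsets. The
    norm is the sup norm, so [U] lies in a cube; the half-side is [|M| + 1] because boundedness
    speaks of radii strictly above [M]. *)
Lemma lebesgue_rV_bounded (R : realType) n (U : set 'rV[R]_n) : bounded_set U ->
  exists V : R, forall B : set 'rV[R]_n, measurable B -> B `<=` U ->
    (lebesgue_rV n B <= V%:E)%E.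
Proof.
move=> [M [_ MU]].
pose box := [set v : 'rV[R]_n | forall i, `[- (`|M| + 1), `|M| + 1]%classic (v ord0 i)].
have boxE : lebesgue_rV n box = (\prod_(i < n) ((`|M| + 1) *+ 2))%:E.
  rewrite /box (lebesgue_rV_box (fun=> measurable_itv _)).
  rewrite -prodEFin; apply: eq_bigr => i _.
  rewrite lebesgue_measure_itv/= lte_fin ifT; last by rewrite gtrN// ltr_wpDl.
  by rewrite -EFinB opprK mulr2n.
exists (\prod_(i < n) ((`|M| + 1) *+ 2)) => B mB BU.
rewrite -boxE; apply: le_measure; rewrite ?inE//.
  rewrite (_ : box = \bigcap_(i in [set: 'I_n])
    ((fun v : 'rV[R]_n => v ord0 i) @^-1` `[- (`|M| + 1), `|M| + 1])).
    apply: fin_bigcap_measurable => // i _.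
    rewrite -[X in measurable X]setTI; apply: measurable_coord => //.
  by apply/seteqP; split => v /= H i => [_|]; exact: H.
move=> v /BU Uv i /=; rewrite in_itv/= -ler_norml.
have : `|v| <= `|M| + 1 by apply: MU => //; rewrite ltr_pwDr// ler_norm.
apply: le_trans; rewrite /Num.Def.normr/= mx_normrE.
exact: (le_bigmax _ (fun ij : 'I_1 * 'I_n => `|v ij.1 ij.2|) (ord0, i)).
Qed.

(** * Complex-valued integrals *)

Section normc_lemmas.
Context {R : rcfType}.
Implicit Types x y z : R[i].
Import Normc.

Lemma normc_ge0 x : 0 <= normc x.
Proof. by case: x => a b; exact: sqrtr_ge0. Qed.

Lemma ler_normcD x y : normc (x + y) <= normc x + normc y.
Proof. exact: le_normcD. Qed.

Lemma normc_distC x y : normc (x - y) = normc (y - x).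
Proof. by rewrite -opprB; exact: normcN. Qed.

Lemma ler_normc_dist x y : normc x <= normc y + normc (x - y).
Proof. by rewrite -{1}(subrK y x) addrC ler_normcD. Qed.

Lemma ler_normc_distD z x y : normc (x - y) <= normc (x - z) + normc (z - y).
Proof. by rewrite -{1}(subrK z x) -addrA ler_normcD. Qed.

Lemma normcB_le x y : normc (x - y) <= normc x + normc y.
Proof. by apply: le_trans (ler_normcD _ _) _; rewrite normcN. Qed.

Lemma normc_real (a : R) : 0 <= a -> normc (a%:C)%C = a.
Proof. by move=> a0; rewrite /= expr0n addr0 sqrtr_sqr ger0_norm. Qed.

Lemma Re_le_normc x : `|complex.Re x| <= normc x.
Proof. by case: x => a b /=; rewrite -sqrtr_sqr ler_wsqrtr// lerDl sqr_ge0. Qed.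

Lemma Im_le_normc x : `|complex.Im x| <= normc x.
Proof. by case: x => a b /=; rewrite -sqrtr_sqr ler_wsqrtr// lerDr sqr_ge0. Qed.

Lemma normc_le_ReIm x : normc x <= `|complex.Re x| + `|complex.Im x|.
Proof.
case: x => a b /=.
have -> : `|a| + `|b| = Num.sqrt ((`|a| + `|b|) ^+ 2).
  by rewrite sqrtr_sqr [RHS]ger0_norm// addr_ge0.
rewrite ler_wsqrtr// sqrrD !real_normK ?num_real// lerD2r lerDl.
by rewrite mulrn_wge0// mulr_ge0.
Qed.

Lemma ReB x y : complex.Re (x - y) = complex.Re x - complex.Re y.
Proof. by case: x y => [a b] [a' b']. Qed.

Lemma ImB x y : complex.Im (x - y) = complex.Im x - complex.Im y.
Proof. by case: x y => [a b] [a' b']. Qed.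

End normc_lemmas.

Section cmeasurable.
Context d (T : measurableType d) (R : realType).
Implicit Types (D : set T) (f g : T -> R[i]).

Lemma cmeasurable_normc D f : cmeasurable_fun D f ->
  measurable_fun D (fun x => Normc.normc (f x)).
Proof.
move=> [mr mi].
rewrite (_ : (fun _ => _) = (@Num.sqrt R) \o
  (fun x => complex.Re (f x) ^+ 2 + complex.Im (f x) ^+ 2)); last first.
  by apply/funext => x /=; case: (f x).
apply: measurableT_comp.
  by apply: continuous_measurable_fun; exact: sqrt_continuous.
by apply: measurable_funD; exact: measurable_funX.
Qed.

Lemma cmeasurable_funM D f g : cmeasurable_fun D f -> cmeasurable_fun D g ->
  cmeasurable_fun D (fun x => f x * g x).
Proof.
move=> [fr fi] [gr gi]; split.
  rewrite (_ : (fun _ => _) = (fun x => complex.Re (f x) * complex.Re (g x)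
     - complex.Im (f x) * complex.Im (g x))).
    by apply: measurable_funB; exact: measurable_funM.
  by apply/funext => x; case: (f x) (g x) => [a b] [a' b'].
rewrite (_ : (fun _ => _) = (fun x => complex.Re (f x) * complex.Im (g x)
     + complex.Im (f x) * complex.Re (g x))).
  by apply: measurable_funD; exact: measurable_funM.
by apply/funext => x; case: (f x) (g x) => [a b] [a' b'].
Qed.

Lemma cmeasurable_real D (h : T -> R) : measurable_fun D h ->
  cmeasurable_fun D (fun x => ((h x)%:C)%C).
Proof. by move=> mh; split => //=; exact: measurable_cst. Qed.

Lemma cmeasurable_cst D (a : R[i]) : cmeasurable_fun D (fun=> a).
Proof. by split; exact: measurable_cst. Qed.

Lemma cmeasurable_funS D E f : measurable E -> D `<=` E ->
  cmeasurable_fun E f -> cmeasurable_fun D f.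
Proof. by move=> mE DE [fr fi]; split; exact: measurable_funS mE DE _. Qed.

Lemma cmeasurable_comp d' (T' : measurableType d') (E : set T') (D : set T)
    (f : T' -> R[i]) (h : T -> T') :
  measurable E -> h @` D `<=` E -> cmeasurable_fun E f -> measurable_fun D h ->
  cmeasurable_fun D (f \o h).
Proof.
move=> mE hE [fr fi] mh; split.
  exact: (measurable_comp (f := fun x => complex.Re (f x)) mE hE fr mh).
exact: (measurable_comp (f := fun x => complex.Im (f x)) mE hE fi mh).
Qed.

End cmeasurable.

Section cintegral_lemmas.
Context d (T : measurableType d) (R : realType) (m : {measure set T -> \bar R}).
Implicit Types (D : set T) (f g : T -> R[i]).
Local Open Scope ereal_scope.

Lemma cintegrable_ReIm D f : measurable D -> cintegrable m D f ->
  m.-integrable D (EFin \o (fun x => complex.Re (f x))) /\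
  m.-integrable D (EFin \o (fun x => complex.Im (f x))).
Proof.
move=> mD [mf lt].
suff H (p : R[i] -> R) : measurable_fun D (fun x => p (f x)) ->
    (forall x, `|p x| <= Normc.normc x)%R ->
    m.-integrable D (EFin \o (fun x => p (f x))).
  case: mf => mr mi.
  by split; apply: H => //; [exact: Re_le_normc|exact: Im_le_normc].
move=> mp pn; apply/integrableP; split; first exact/measurable_EFinP.
apply: le_lt_trans lt; apply: ge0_le_integral => //=.
- by apply/measurable_EFinP; exact: measurableT_comp.
- by apply/measurable_EFinP; exact: cmeasurable_normc.
- by move=> x _; rewrite lee_fin pn.
Qed.

Lemma cintegrable_le D f (h : T -> R) : measurable D -> cmeasurable_fun D f ->
  measurable_fun D h -> (forall x, D x -> Normc.normc (f x) <= h x)%R ->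
  \int[m]_(x in D) (h x)%:E < +oo -> cintegrable m D f.
Proof.
move=> mD mf mh fh hoo; split => //; apply: le_lt_trans hoo.
apply: ge0_le_integral => //.
- by move=> x _; rewrite lee_fin normc_ge0.
- by apply/measurable_EFinP; exact: cmeasurable_normc.
- exact/measurable_EFinP.
Qed.

(** Extension by zero turns the integrals over two domains into integrals over the whole space,
    where they can be subtracted. *)
Lemma Rintegral_dist_le D1 D2 (f g h : T -> R) :
  measurable D1 -> measurable D2 ->
  m.-integrable D1 (EFin \o f) -> m.-integrable D2 (EFin \o g) ->
  measurable_fun setT h ->
  (forall x, `|(f \_ D1) x - (g \_ D2) x| <= h x)%R ->
  (`|Rintegral m D1 f - Rintegral m D2 g|)%:E <= \int[m]_x (h x)%:E.
Proof.
move=> mD1 mD2 fi gi mh fgh.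
have fi' : m.-integrable setT (EFin \o f \_ D1).
  by rewrite -restrict_EFin; exact: (iffLR (integrable_mkcond _ mD1) fi).
have gi' : m.-integrable setT (EFin \o g \_ D2).
  by rewrite -restrict_EFin; exact: (iffLR (integrable_mkcond _ mD2) gi).
rewrite (Rintegral_mkcond _ _ f) (Rintegral_mkcond _ _ g) -RintegralB//.
have fgi : m.-integrable setT (EFin \o (fun x => (f \_ D1) x - (g \_ D2) x)%R).
  exact: (integrableB measurableT fi' gi').
rewrite -abse_EFin fineK; last exact: (integrable_fin_num measurableT fgi).
apply: le_trans (le_abse_integral _ measurableT (measurable_int _ fgi)) _.
apply: ge0_le_integral => //=.
- apply/measurable_EFinP; apply: measurableT_comp => //.
  exact/measurable_EFinP/(measurable_int _ fgi).
- exact/measurable_EFinP.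
- by move=> x _; rewrite lee_fin.
Qed.

(** The factor [2] comes from estimating the real and imaginary parts separately. The three
    pointwise conditions treat the common part of the domains and the two sides of their
    mismatch. *)
Lemma cintegral_dist_le D1 D2 f g (h : T -> R) :
  measurable D1 -> measurable D2 ->
  cintegrable m D1 f -> cintegrable m D2 g ->
  measurable_fun setT h -> (forall x, 0 <= h x)%R ->
  (forall x, D1 x -> D2 x -> Normc.normc (f x - g x) <= h x)%R ->
  (forall x, D1 x -> ~ D2 x -> Normc.normc (f x) <= h x)%R ->
  (forall x, ~ D1 x -> D2 x -> Normc.normc (g x) <= h x)%R ->
  (Normc.normc (cintegral m D1 f - cintegral m D2 g))%:E
    <= 2%:E * \int[m]_x (h x)%:E.
Proof.
move=> mD1 mD2 /(cintegrable_ReIm mD1)[fr fi] /(cintegrable_ReIm mD2)[gr gi].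
move=> mh h0 h12 h1 h2.
(* [p] stands for the real or the imaginary part; compatibility with subtraction and domination by
   the modulus are all that matters. *)
have H (p : R[i] -> R) : (forall x y, p (x - y) = p x - p y)%R ->
    (forall x, `|p x| <= Normc.normc x)%R ->
    forall x, (`|((p \o f) \_ D1) x - ((p \o g) \_ D2) x| <= h x)%R.
  move=> pB pn x; rewrite !patchE (_ : point = 0%R)//.
  have [/[!inE] x1|/negP/[!inE] x1] := boolP (x \in D1);
    have [/[!inE] x2|/negP/[!inE] x2] := boolP (x \in D2).
  - by rewrite /= -pB (le_trans (pn _))// h12.
  - by rewrite subr0 (le_trans (pn _))// h1.
  - by rewrite sub0r normrN (le_trans (pn _))// h2.
  - by rewrite subrr normr0.
apply: (@le_trans _ _ ((`|complex.Re (cintegral m D1 f - cintegral m D2 g)|)%:E +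
    (`|complex.Im (cintegral m D1 f - cintegral m D2 g)|)%:E)).
  by rewrite -EFinD lee_fin normc_le_ReIm.
rewrite (_ : 2%:E = 1 + 1)// ge0_muleDl// !mul1e leeD//.
- rewrite ReB; apply: (@Rintegral_dist_le D1 D2 _ _ h) => //.
  by apply: H; [exact: ReB|exact: Re_le_normc].
- rewrite ImB; apply: (@Rintegral_dist_le D1 D2 _ _ h) => //.
  by apply: H; [exact: ImB|exact: Im_le_normc].
Qed.

End cintegral_lemmas.

Section cintegral_estimates.
Context d (T : measurableType d) (R : realType) (m : {measure set T -> \bar R}).
Implicit Types (D : set T) (f g : T -> R[i]).

Lemma cintegrableZl D (a : R[i]) f : measurable D -> cintegrable m D f ->
  cintegrable m D (fun x => a * f x).
Proof.
move=> mD [mf foo]; split; first exact/cmeasurable_funM/mf/cmeasurable_cst.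
under eq_integral do rewrite Normc.normcM EFinM.
rewrite ge0_integralZl//.
- by rewrite lte_mul_pinfty// lee_fin normc_ge0.
- by apply/measurable_EFinP; exact: cmeasurable_normc.
- by move=> x _; rewrite lee_fin normc_ge0.
- by rewrite lee_fin normc_ge0.
Qed.

Lemma cintegralZl D (a : R[i]) f : measurable D -> cintegrable m D f ->
  cintegral m D (fun x => a * f x) = a * cintegral m D f.
Proof.
move=> mD /(cintegrable_ReIm mD)[fr fi]; rewrite /cintegral.
have Zi (k : R) (h : T -> R) : m.-integrable D (EFin \o h) ->
    m.-integrable D (EFin \o (fun x => k * h x)).
  move=> hi; apply: eq_integrable (integrableZl mD k hi) => //.
case: a => a1 a2.
have -> : Rintegral m D (fun x => complex.Re ((a1 +i* a2)%C * f x)) =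
    a1 * Rintegral m D (fun x => complex.Re (f x)) -
    a2 * Rintegral m D (fun x => complex.Im (f x)).
  rewrite -!RintegralZl// -RintegralB//; [|exact: Zi|exact: Zi].
  by apply: eq_Rintegral => x _; case: (f x).
have -> : Rintegral m D (fun x => complex.Im ((a1 +i* a2)%C * f x)) =
    a1 * Rintegral m D (fun x => complex.Im (f x)) +
    a2 * Rintegral m D (fun x => complex.Re (f x)).
  rewrite -!RintegralZl// -RintegralD//; [|exact: Zi|exact: Zi].
  by apply: eq_Rintegral => x _; case: (f x).
by [].
Qed.

Lemma normc_cintegral_le D f (h : T -> R) : measurable D -> cintegrable m D f ->
  measurable_fun D h -> (forall x, D x -> Normc.normc (f x) <= h x) ->
  ((Normc.normc (cintegral m D f))%:E <= 2%:E * \int[m]_(x in D) (h x)%:E)%E.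
Proof.
move=> mD fi mh fh.
(* The bound is the two-domain comparison with the empty set as second domain. *)
have c0 : cintegral m set0 f = 0.
  by rewrite /cintegral !Rintegral_set0.
have f0 : cintegrable m set0 f.
  split; last by rewrite integral_set0 ltry.
  by split; exact: measurable_fun_set0.
rewrite -[cintegral m D f]subr0 -c0 integral_mkcond.
under eq_integral do rewrite restrict_EFin.
have h0 x : D x -> 0 <= h x by move=> Dx; apply: le_trans (fh x Dx); exact: normc_ge0.
have hD x : D x -> (h \_ D) x = h x by move=> Dx; rewrite patchE mem_set.
apply: (@cintegral_dist_le _ _ _ _ D set0 f f (h \_ D)) => //.
- exact: (iffLR (measurable_restrictT _ mD) mh).
- move=> x; rewrite patchE; case: ifPn => // /set_mem; exact: h0.
- by move=> x Dx _; rewrite hD// fh.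
Qed.

Lemma cintegrable_bounded D f (M : R) : measurable D -> cmeasurable_fun D f ->
  (m D < +oo)%E -> (forall x, D x -> Normc.normc (f x) <= M) ->
  cintegrable m D f.
Proof.
move=> mD mf Doo fM; apply: (cintegrable_le (h := cst `|M|)) => //.
  by move=> x Dx; apply: le_trans (fM x Dx) (ler_norm _).
have -> : (\int[m]_(x in D) (cst `|M| x)%:E = `|M|%:E * m D)%E.
  by rewrite -integral_cst.
by rewrite lte_mul_pinfty// lee_fin.
Qed.

Lemma ge0_integral_lin2 (a1 a2 : R) (f1 f2 : T -> R) : 0 <= a1 -> 0 <= a2 ->
  measurable_fun setT f1 -> measurable_fun setT f2 ->
  (forall x, 0 <= f1 x) -> (forall x, 0 <= f2 x) ->
  (\int[m]_x (a1 * f1 x + a2 * f2 x)%:E =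
   a1%:E * \int[m]_x (f1 x)%:E + a2%:E * \int[m]_x (f2 x)%:E)%E.
Proof.
move=> a10 a20 mf1 mf2 f10 f20.
under eq_integral do rewrite EFinD !EFinM.
have mf1' : measurable_fun setT (EFin \o f1) by exact/measurable_EFinP.
have mf2' : measurable_fun setT (EFin \o f2) by exact/measurable_EFinP.
rewrite ge0_integralD//.
- rewrite !ge0_integralZl//.
  + by move=> x _; rewrite lee_fin.
  + by move=> x _; rewrite lee_fin.
- by move=> x _; rewrite -EFinM lee_fin mulr_ge0.
- apply: emeasurable_funM => //.
- by move=> x _; rewrite -EFinM lee_fin mulr_ge0.
- exact: emeasurable_funM.
Qed.

(** This transfers a mass bound from one domain to another; pointwise it is the triangle inequality
    for indicators. *)
Lemma integral_indic_dist (D1 D2 : set T) (w : T -> R) :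
  measurable D1 -> measurable D2 -> measurable_fun setT w ->
  (forall x, 0 <= w x) ->
  (\int[m]_(x in D1) (w x)%:E <= \int[m]_(x in D2) (w x)%:E +
    \int[m]_x (`|\1_D1 x - \1_D2 x| * w x)%:E)%E.
Proof.
move=> mD1 mD2 mw w0.
have mw' : measurable_fun setT (EFin \o w) by exact/measurable_EFinP.
have mi : measurable_fun setT
    (fun x => (`|\1_D1 x - \1_D2 x| * w x)%:E : \bar R).
  apply/measurable_EFinP/measurable_funM => //.
  by apply: measurableT_comp => //; exact: measurable_funB.
have wD2 x : (0 <= ((EFin \o w) \_ D2) x)%E.
  by apply: erestrict_ge0 => y _; rewrite lee_fin.
rewrite integral_mkcond [X in (_ <= X + _)%E]integral_mkcond -ge0_integralD//.
- apply: ge0_le_integral => //.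
  + by move=> x _; apply: erestrict_ge0 => y _; rewrite lee_fin.
  + exact: (iffLR (measurable_restrictT _ mD1) (measurable_funTS mw')).
  + apply: emeasurable_funD => //.
    exact: (iffLR (measurable_restrictT _ mD2) (measurable_funTS mw')).
  + move=> x _; rewrite !patchE !indicE.
    case: (x \in D1); case: (x \in D2) => /=.
    * by rewrite -EFinD lee_fin subrr normr0 mul0r addr0.
    * by rewrite add0e lee_fin subr0 normr1 mul1r.
    * by rewrite -EFinD lee_fin addr_ge0// mulr_ge0.
    * by rewrite add0e lee_fin subrr normr0 mul0r.
- exact: (iffLR (measurable_restrictT _ mD2) (measurable_funTS mw')).
- by move=> x _; rewrite lee_fin mulr_ge0.
Qed.

End cintegral_estimates.

(** * Measurable dependence of section integrals on the parameter *)

Section parametric_integral.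
Context d1 d2 (P : measurableType d1) (T : measurableType d2) (R : realType).
Variable m : {sigma_finite_measure set T -> \bar R}.
Variables (A : P -> set T).
Hypothesis mA : measurable [set x : P * T | A x.1 x.2].

Lemma measurable_section p : measurable (A p).
Proof.
have := measurable_xsection p mA.
rewrite (_ : xsection _ _ = A p)//.
by apply/seteqP; split => t; rewrite /xsection/= inE.
Qed.

Lemma measurable_fun_section d' (T' : measurableType d') (f : P -> T -> T') p :
  measurable_fun [set x : P * T | A x.1 x.2] (fun x => f x.1 x.2) ->
  measurable_fun (A p) (f p).
Proof.
move=> mf; apply: (measurable_comp (f := fun x : P * T => f x.1 x.2)
  (g := fun t => (p, t)) mA) => //.
- by move=> _ [t At <-].
- exact: measurable_funTS (pair1_measurable p).
Qed.

Lemma cmeasurable_fun_section (f : P -> T -> R[i]) p :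
  cmeasurable_fun [set x : P * T | A x.1 x.2] (fun x => f x.1 x.2) ->
  cmeasurable_fun (A p) (f p).
Proof.
move=> [fr fi]; split.
  exact: (measurable_fun_section (f := fun p t => complex.Re (f p t)) fr).
exact: (measurable_fun_section (f := fun p t => complex.Im (f p t)) fi).
Qed.

(** Tonelli gives measurability for the positive and negative parts of the zero extension.
    Integrability of each section makes their difference finite, so that [fine] loses nothing. *)
Lemma measurable_Rintegral_section (f : P -> T -> R) :
  measurable_fun [set x : P * T | A x.1 x.2] (fun x => f x.1 x.2) ->
  (forall p, m.-integrable (A p) (EFin \o f p)) ->
  measurable_fun setT (fun p => Rintegral m (A p) (f p)).
Proof.
move=> mf fi.
pose F := EFin \o ((fun x : P * T => f x.1 x.2) \_ [set x : P * T | A x.1 x.2]).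
have mF : measurable_fun setT F.
  apply/measurable_EFinP; exact: (iffLR (measurable_restrictT _ mA) mf).
have FE p : (\int[m]_(t in A p) (f p t)%:E =
    fubini_F m F^\+ p - fubini_F m F^\- p)%E.
  rewrite integral_mkcond.
  have -> : (fun t => (f p t)%:E) \_ (A p) = F \o pair p.
    apply/funext => t; rewrite /F/= !patchE/=.
    have -> : (t \in A p) = ((p, t) \in [set x : P * T | A x.1 x.2]).
      by apply/idP/idP; rewrite !inE.
    by case: ifP.
  by rewrite integralE funepos_comp funeneg_comp.
apply/measurable_EFinP.
rewrite (_ : EFin \o _ = fun p => fubini_F m F^\+ p - fubini_F m F^\- p)%E.
  apply: emeasurable_funB; apply: measurable_fun_fubini_tonelli_F => //.
  - exact: measurable_funepos.
  - exact: measurable_funeneg.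
apply/funext => p /=; rewrite -FE fineK//.
exact: (integrable_fin_num (measurable_section p) (fi p)).
Qed.

Lemma cmeasurable_cintegral_section (f : P -> T -> R[i]) :
  cmeasurable_fun [set x : P * T | A x.1 x.2] (fun x => f x.1 x.2) ->
  (forall p, cintegrable m (A p) (f p)) ->
  cmeasurable_fun setT (fun p => cintegral m (A p) (f p)).
Proof.
move=> [fr fi] fint; split; apply: measurable_Rintegral_section => // p.
- by have [] := cintegrable_ReIm (measurable_section p) (fint p).
- by have [] := cintegrable_ReIm (measurable_section p) (fint p).
Qed.

End parametric_integral.

(** * Change of variables on dilated sets *)

Section dilation_image_integral.
Context {R : realType} {n : nat} (beta : 'I_n -> R) (u : R).
Hypothesis u0 : 0 < u.
Local Open Scope ereal_scope.
Let lam := lebesgue_rV (R := R) n.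
Implicit Types A : set 'rV[R]_n.

Lemma measurable_dilation_image A : measurable A ->
  measurable (dilation beta u @` A).
Proof.
move=> mA; rewrite dilation_image// -[X in measurable X]setTI.
exact: measurable_dilation.
Qed.

Lemma measurable_fun_dilation_image d' (T' : measurableType d') A
    (f : 'rV[R]_n -> T') : measurable A -> measurable_fun A f ->
  measurable_fun (dilation beta u @` A) (f \o dilation beta u^-1).
Proof.
move=> mA mf; apply: (measurable_comp mA) => //.
  by move=> _ [_ [t At <-] <-]; rewrite dilationK.
by apply: measurable_funTS; exact: measurable_dilation.
Qed.

Lemma ge0_integral_dilation_image A (f : 'rV[R]_n -> \bar R) :
  measurable A -> measurable_fun A f -> (forall t, A t -> 0 <= f t) ->
  \int[lam]_(t in dilation beta u @` A) f (dilation beta u^-1 t) =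
  (u `^ \sum_i beta i)%:E * \int[lam]_(t in A) f t.
Proof.
move=> mA mf f0; rewrite integral_mkcond [in RHS]integral_mkcond.
have mfA : measurable_fun setT (f \_ A).
  exact: (iffLR (measurable_restrictT _ mA) mf).
have fA0 t : 0 <= (f \_ A) t by apply: erestrict_ge0.
rewrite (ge0_integral_dilation beta u0); first last.
- by move=> t; apply: erestrict_ge0 => _ [s As <-]; rewrite dilationK// f0.
- apply: (iffLR (measurable_restrictT _ (measurable_dilation_image mA))).
  exact: measurable_fun_dilation_image.
congr (_ * _); apply: eq_integral => t _.
rewrite dilation_image// !patchE /=.
have -> : (dilation beta u t \in dilation beta u^-1 @^-1` A) = (t \in A).
  by apply/idP/idP; rewrite !inE/= dilationK.
by rewrite dilationK.
Qed.

(** The nonnegative formula is applied to the positive and negative parts; integrability makes both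
    finite, which lets the Jacobian factor out of their difference. *)
Lemma Rintegral_dilation_image A (f : 'rV[R]_n -> R) : measurable A ->
  lam.-integrable A (EFin \o f) ->
  Rintegral lam (dilation beta u @` A) (f \o dilation beta u^-1) =
  (u `^ (\sum_i beta i) * Rintegral lam A f)%R.
Proof.
move=> mA fi.
have mf := measurable_int _ fi.
have [pfin nfin] := (integrable_pos_fin_num mA fi, integrable_neg_fin_num mA fi).
rewrite /Rintegral integralE [X in (_ = _ * fine X)%R]integralE.
rewrite -/(EFin \o f \o dilation beta u^-1) funepos_comp funeneg_comp.
have -> : \int[lam]_(x in dilation beta u @` A)
   ((EFin \o f)^\+ \o dilation beta u^-1) x =
   (u `^ \sum_i beta i)%:E * \int[lam]_(t in A) (EFin \o f)^\+ t.
  by rewrite -ge0_integral_dilation_image//; exact: measurable_funepos.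
have -> : \int[lam]_(x in dilation beta u @` A)
   ((EFin \o f)^\- \o dilation beta u^-1) x =
   (u `^ \sum_i beta i)%:E * \int[lam]_(t in A) (EFin \o f)^\- t.
  by rewrite -ge0_integral_dilation_image//; exact: measurable_funeneg.
by rewrite -muleBr// ?fineM//; [rewrite fin_numB pfin nfin|exact: fin_num_adde_defr].
Qed.

Lemma cintegrable_dilation_image A (f : 'rV[R]_n -> R[i]) : measurable A ->
  cintegrable lam A f ->
  cintegrable lam (dilation beta u @` A) (f \o dilation beta u^-1).
Proof.
move=> mA [[fr fi] foo]; split.
  split.
    exact: (measurable_fun_dilation_image (f := fun t => complex.Re (f t)) mA fr).
  exact: (measurable_fun_dilation_image (f := fun t => complex.Im (f t)) mA fi).
rewrite (ge0_integral_dilation_image (f := fun t => (Normc.normc (f t))%:E) mA).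
- by rewrite lte_mul_pinfty// lee_fin powR_ge0.
- by apply/measurable_EFinP; exact: cmeasurable_normc.
- by move=> t _; rewrite lee_fin normc_ge0.
Qed.

Lemma cintegral_dilation_image A (f : 'rV[R]_n -> R[i]) : measurable A ->
  cintegrable lam A f ->
  cintegral lam (dilation beta u @` A) (f \o dilation beta u^-1) =
  (((u `^ (\sum_i beta i))%:C)%C * cintegral lam A f)%R.
Proof.
move=> mA /(cintegrable_ReIm mA)[fr fi]; rewrite /cintegral.
rewrite (Rintegral_dilation_image mA fr) (Rintegral_dilation_image mA fi).
by apply/eqP; rewrite eq_complex/= !mul0r subr0 addr0 !eqxx.
Qed.

End dilation_image_integral.

(** * Uniform suprema and rescaled kernels *)

Section nnsup_lemmas.
Context {R : realType} {T : Type}.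
Implicit Types (D : set T) (f : T -> \bar R).
Local Open Scope ereal_scope.

Lemma nnsup_ge0 D f : 0 <= nnsup D f.
Proof. by apply: ereal_sup_ubound; left. Qed.

Lemma le_nnsup D f x : D x -> f x <= nnsup D f.
Proof. by move=> Dx; apply: ereal_sup_ubound; right; exists x. Qed.

Lemma nnsup_le D f e : 0 <= e -> (forall x, D x -> f x <= e) -> nnsup D f <= e.
Proof. by move=> e0 fe; apply: ub_ereal_sup => _ [->//|[x Dx <-]]; exact: fe. Qed.

(** Since [nnsup] is nonnegative, convergence to [0] amounts to eventual upper bounds. The uniform
    hypotheses and the uniform conclusion are used in this form. *)
Lemma nnsup_cvg0P (I : Type) (F : set_system I) (D : I -> set T)
    (f : I -> T -> \bar R) : Filter F ->
  nnsup (D i) (f i) @[i --> F] --> 0 <->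
  (forall e : R, (0 < e)%R ->
    \forall i \near F, forall x, D i x -> f i x <= e%:E).
Proof.
move=> FF; split.
  move=> /fine_cvgP[ffin /cvgrPdist_le f0] e e0.
  have := f0 _ e0; apply: filterS2 ffin => i ifin.
  rewrite sub0r normrN /= ger0_norm; last by rewrite fine_ge0// nnsup_ge0.
  move=> ie x Dx; apply: le_trans (le_nnsup _ Dx) _.
  by rewrite -(fineK ifin) lee_fin.
move=> H; apply/fine_cvgP; split.
  have := H 1%R ltr01; apply: filterS => i Hi.
  rewrite ge0_fin_numE ?nnsup_ge0//.
  by apply: le_lt_trans (ltry 1); apply: nnsup_le.
apply/cvgrPdist_le => e e0; have := H e e0; apply: filterS => i Hi.
have le : nnsup (D i) (f i) <= e%:E by apply: nnsup_le => //; rewrite lee_fin ltW.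
rewrite sub0r normrN /= ger0_norm; last by rewrite fine_ge0// nnsup_ge0.
rewrite -lee_fin fineK// ge0_fin_numE ?nnsup_ge0//.
exact: le_lt_trans le (ltry _).
Qed.

Lemma limf_esup_lt (I : choiceType) (X : filteredType I) (f : X -> \bar R)
    (F : set_system X) (e : \bar R) : Filter F ->
  limf_esup f F < e -> \forall x \near F, f x < e.
Proof.
move=> FF; rewrite /limf_esup => /ereal_inf_lt[_ [V FV <-] Ve].
apply: filterS FV => x Vx; apply: le_lt_trans Ve.
by apply: ereal_sup_ubound; exists x.
Qed.

End nnsup_lemmas.

Section kernel_lemmas.
Context {R : realType}.

(** The gap between the two rates pays for the polynomial factor. *)
Lemma powR_expR_bound (C r eta eta' : R) : 0 <= r -> eta' < eta ->
  exists2 C' : R, 0 <= C' & forall v, 0 <= v ->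
    C * (1 + v) `^ r * expR (- (eta * v)) <= C' * expR (- (eta' * v)).
Proof.
move=> r0 ee.
(* Dividing by [r + 1] covers [r = 0] and still gives [a * r <= eta - eta']. With [m] the minimum of
   [1] and [a], one has [m * (1 + v) <= 1 + a * v <= expR (a * v)], and raising this to the power
   [r] costs only the rate [a * r]. *)
pose a := (eta - eta') / (r + 1).
have a0 : 0 < a by rewrite divr_gt0 ?subr_gt0// ltr_wpDl.
have ar : a * r <= eta - eta'.
  rewrite /a mulrAC ler_pdivrMr; last by rewrite ltr_wpDl.
  by apply: ler_wpM2l; [rewrite subr_ge0 ltW|rewrite lerDl].
pose m := Num.min 1 a.
have m0 : 0 < m by rewrite lt_min ltr01.
exists (`|C| * m^-1 `^ r) => [|v v0]; first by rewrite mulr_ge0 ?powR_ge0.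
apply: (@le_trans _ _ (`|C| * (1 + v) `^ r * expR (- (eta * v)))).
  by rewrite !ler_wpM2r ?expR_ge0 ?powR_ge0// ler_norm.
rewrite -2!mulrA; apply: ler_wpM2l => //.
have v1 : 1 + v <= m^-1 * expR (a * v).
  rewrite mulrC ler_pdivlMr//; apply: le_trans (expR_ge1Dx _).
  rewrite mulrDl mul1r lerD//; first by rewrite ge_min lexx.
  by rewrite mulrC ler_wpM2r// ge_min lexx orbT.
have : (1 + v) `^ r <= m^-1 `^ r * expR (a * v * r).
  rewrite expRM -powRM ?expR_ge0 ?invr_ge0 ?(ltW m0)//.
  by rewrite ge0_ler_powR// nnegrE ?addr_ge0// mulr_ge0 ?expR_ge0 ?invr_ge0 ?(ltW m0).
move=> /(ler_wpM2r (expR_ge0 (- (eta * v)))) /le_trans; apply.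
rewrite -[leLHS]mulrA ler_wpM2l ?powR_ge0// -expRD ler_expR.
rewrite mulrAC -subr_ge0.
rewrite (_ : _ - _ = (eta - eta' - a * r) * v); last by ring.
by rewrite mulr_ge0// subr_ge0.
Qed.

Lemma within_continuous_normc (D : set R) (g : R -> R[i]) x (e : R) :
  {within D, continuous (g : R -> R[i]^o)} -> D x -> 0 < e ->
  \forall y \near x, D y -> Normc.normc (g x - g y) < e.
Proof.
move=> /subspace_continuousP gc Dx e0.
have /cvgrPdist_lt/(_ (e%:C)%C) := gc x Dx.
rewrite ltcR => /(_ e0); rewrite near_withinE; apply: filterS => y H Dy.
by have := H Dy; rewrite normc_def ltcR; case: (g x - g y).
Qed.

Lemma within_continuous_cmeasurable (D : set R) (g : R -> R[i]) : measurable D ->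
  {within D, continuous (g : R -> R[i]^o)} -> cmeasurable_fun D g.
Proof.
move=> mD gc.
suff H (p : R[i] -> R) : (forall x y, p (x - y) = p x - p y) ->
    (forall x, `|p x| <= Normc.normc x) -> measurable_fun D (fun x => p (g x)).
  split; first exact: H (@ReB R) (@Re_le_normc R).
  exact: H (@ImB R) (@Im_le_normc R).
move=> pB pn; apply: (@subspace_continuous_measurable_fun _ _ (fun x => p (g x))) => //.
apply/subspace_continuousP => x Dx; apply/cvgrPdist_lt => e e0.
rewrite near_withinE; apply: filterS (within_continuous_normc gc Dx e0) => y H Dy.
by rewrite -pB; apply: le_lt_trans (pn _) (H Dy).
Qed.

Lemma locally_uniform_cvg_at (f : R -> R -> R[i]) (g : R -> R[i]) (v e : R) :
  locally_uniform_cvg f g -> 0 <= v -> 0 < e ->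
  \forall x \near v & z \near +oo, 0 <= x -> Normc.normc (f z x - g x) <= e.
Proof.
move=> fg v0 e0; have [V vV /nnsup_cvg0P/(_ e e0) H] := fg v v0.
exists (V, [set z | forall x, (V `&` `[0, +oo[) x ->
    ((Normc.normc (f z x - g x))%:E <= e%:E)%E]) => //= -[x z] /= [Vx Hz] x0.
by rewrite -lee_fin Hz//=; split => //; rewrite in_itv/= x0.
Qed.

(** The kernel and its limit are evaluated at different points, so one [delta] must work along the
    whole segment. Only [x] is confined to it; [y] may lie slightly beyond [M]. *)
Lemma locally_uniform_cvg_segment (f : R -> R -> R[i]) (g : R -> R[i]) (M e : R) :
  {within `[0, +oo[, continuous (g : R -> R[i]^o)} ->
  locally_uniform_cvg f g -> 0 < e ->
  exists2 delta : R, 0 < delta & \forall z \near +oo,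
    forall x y, 0 <= x <= M -> 0 <= y -> `|x - y| < delta ->
    Normc.normc (f z x - g y) <= e.
Proof.
move=> gc fg e0.
have e3 : 0 < e / 3 by rewrite divr_gt0.
(* The covering parameter is the pair of [delta] and [z], with [delta] tending to [0] from the right
   and [z] to infinity; compactness then makes both uniform in [x] at once. *)
pose Q (i : R * R) x := forall y, 0 <= x -> 0 <= y -> `|x - y| < i.1 ->
    Normc.normc (f i.2 x - g y) <= e.
have K : near_covering `[0 : R, M].
  exact/compact_near_coveringP/segment_compact.
have [|[B1 B2] /= [B10 B2z] BQ] := K _ (filter_prod (0:R)^'+ +oo) Q _.
  move=> x /=; rewrite in_itv/= => /andP[x0 xM].
  have gx : \forall y \near x, 0 <= y -> Normc.normc (g x - g y) < e / 3.
    have := within_continuous_normc gc _ e3.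
    move=> /(_ x); rewrite /= in_itv/= x0 => /(_ isT).
    by apply: filterS => y H y0; apply: H; rewrite in_itv/= y0.
  have [rho /= rho0 xrho] := gx.
  have [[W Z] /= [xW zZ] WZ] := locally_uniform_cvg_at fg x0 e3.
  (* Half radii put both [x'] and [y] within [rho] of the centre [x], where [Kinf] varies by less
     than [e / 3]. *)
  exists (W `&` ball x (rho / 2), [set i : R * R | i.1 < rho / 2 /\ Z i.2]).
    split => /=.
      by apply: filterI => //; exact: nbhsx_ballx (divr_gt0 rho0 _).
    exists ([set r | r < rho / 2], Z) => //=; split => //.
    exact: nbhs_right_lt (divr_gt0 rho0 _).
  move=> [x' [de z]] /= [[Wx' xx'] [de2 Zz]] y x'0 y0 x'y.
  have h1 : Normc.normc (f z x' - g x') <= e / 3 by apply: (WZ (x', z)).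
  have h2 : Normc.normc (g x - g x') < e / 3.
    by apply: xrho => //; apply: lt_trans xx' _; rewrite ltr_pdivrMr// ltr_pMr// ltr1n.
  have h3 : Normc.normc (g x - g y) < e / 3.
    apply: xrho => //; rewrite /ball/= in xx' *.
    rewrite (_ : x - y = (x - x') + (x' - y)); last by ring.
    rewrite (splitr rho); apply: le_lt_trans (ler_normD _ _) _.
    by rewrite ltrD// (lt_trans x'y).
  apply: le_trans (ler_normc_distD (g x') _ _) _.
  have := ler_normc_distD (g x) (g x') (g y).
  rewrite (normc_distC (g x') (g x)) => h4.
  move: h1 h2 h3 h4; lra.
have [rho /= rho0 B1rho] := B10.
exists (rho / 2); first exact: divr_gt0.
apply: filterS B2z => z B2z x y xM y0 xy.
apply: (BQ (rho / 2, z)) => //=.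
- split => //; apply: B1rho => /=; last exact: divr_gt0.
  rewrite /ball/= sub0r normrN gtr0_norm ?divr_gt0//.
  by rewrite ltr_pdivrMr// ltr_pMr// ltr1n.
- by move: xM => /andP[].
Qed.

Lemma locally_uniform_cvg_bound (f : R -> R -> R[i]) (g : R -> R[i]) (h : R -> R) :
  locally_uniform_cvg f g ->
  (\forall z \near +oo, forall v, 0 <= v -> Normc.normc (f z v) <= h v) ->
  forall v, 0 <= v -> Normc.normc (g v) <= h v.
Proof.
move=> fg fh v v0; apply/ler_addgt0Pr => e e0.
have [[V Z] /= [vV zZ] VZ] := locally_uniform_cvg_at fg v0 e0.
near (+oo : set_system R) => z.
have fz : Normc.normc (f z v) <= h v by near: z; apply: filterS fh => z; exact.
apply: le_trans (ler_normc_dist _ (f z v)) _; rewrite lerD// normc_distC.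
apply: (VZ (v, z)) => //=; split; first exact: nbhs_singleton.
by near: z.
Unshelve. all: by end_near. Qed.

End kernel_lemmas.

(** * Uniform asymptotics of the kernel integral *)

Section rescaled_kernel_integral.
Context {R : realType} {dP : measure_display} {P : measurableType dP} {d : nat}.
Variables (U : set 'rV[R]_d) (A Ainf : P -> set 'rV[R]_d).
Hypothesis hUb : bounded_set U.
Hypothesis hAU : forall p, A p `<=` U.
Hypothesis hA : measurable [set x : P * 'rV[R]_d | A x.1 x.2].
Hypothesis hAinf : measurable [set x : P * 'rV[R]_d | Ainf x.1 x.2].
Variable beta : 'I_d -> R.
Hypothesis hbeta : forall i, 0 < beta i.
Variables (c : P -> R) (cminus cplus : R).
Hypothesis hc : measurable_fun setT c.
Hypothesis hcminus : 0 < cminus.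
Hypothesis hcbound : forall p, cminus <= c p <= cplus.
Variable G : P -> 'rV[R]_d -> R.
Hypothesis hG : measurable_fun setT (fun x : P * 'rV[R]_d => G x.1 x.2).
Hypothesis hG0 : forall p t, 0 <= G p t.
Hypothesis hGhom : forall p t (u : R), 0 < u -> G p (dilation beta u t) = u * G p t.
Variable gplus : R.
Hypothesis hGsup : (nnsup [set x : P * 'rV[R]_d | weighted_gauge beta x.2 = 1%R]
              (fun x => (G x.1 x.2)%:E) <= gplus%:E)%E.
Variables (mu : R) (phi : P -> 'rV[R]_d -> R) (b : P -> 'rV[R]_d -> R[i]).
Hypothesis hmu : 0 <= mu.
Hypothesis hphi : measurable_fun [set x : P * 'rV[R]_d | A x.1 x.2]
            (fun x => phi x.1 x.2).
Hypothesis hb : cmeasurable_fun [set x : P * 'rV[R]_d | A x.1 x.2]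
            (fun x => b x.1 x.2).
Hypothesis hphimu : forall p s, A p s -> mu <= phi p s.
Variables (b0 : P -> R[i]) (M0 : R).
Hypothesis hb0 : cmeasurable_fun setT b0.
Hypothesis hb0bound : forall p, Normc.normc (b0 p) <= M0.
Variable K : R -> R[i].
Hypothesis hK : cmeasurable_fun (`[0, +oo[ : set R) K.
Variable M : R.
Hypothesis hbbound : forall p s, A p s -> Normc.normc (b p s) <= M.
Hypothesis hlocal : forall T : R,
    nnsup [set x : P * 'rV[R]_d |
            rescaled_set beta c A z x.1 x.2 /\ weighted_gauge beta x.2 <= T]
      (fun x =>
        (Normc.normc (b x.1 (unscale beta c z x.1 x.2) - b0 x.1)
         + `|rescaled_phase beta c phi mu z x.1 x.2 - G x.1 x.2|)%:E)
      @[z --> +oo] --> 0%E.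
Variable kappaG : R.
Hypothesis hkappaG : 0 < kappaG.
Hypothesis hcoercive : \forall z \near +oo, forall p t, rescaled_set beta c A z p t ->
    kappaG * G p t <= rescaled_phase beta c phi mu z p t.
Variable NK : R -> R.
Hypothesis hNK : forall z : R, 0 < z -> 0 < NK z.
Variable Kinf : R -> R[i].
Hypothesis hKinf : {within `[0, +oo[, continuous (Kinf : R -> R[i]^o)}.
Hypothesis hKlim : locally_uniform_cvg (rescaled_kernel K NK mu) Kinf.
Variables (C r eta : R).
Hypothesis hr : 0 <= r.
Hypothesis hKbound : \forall z \near +oo, forall v, 0 <= v ->
    Normc.normc (rescaled_kernel K NK mu z v)
      <= C * (1 + v) `^ r * expR (- (eta * v)).
Variable gamma : R.
Hypothesis hgamma0 : 0 < gamma.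
Hypothesis hgamma1 : gamma < Num.min 1 (Num.min (eta * kappaG) eta).
Hypothesis hset : nnsup setT (fun p =>
      (\int[lebesgue_rV d]_t
         (`|\1_(rescaled_set beta c A z p) t - \1_(Ainf p) t|
          * expR (- (gamma * G p t)))%:E)%E)
    @[z --> +oo] --> 0%E.
Hypothesis htail : limf_esup (fun z : R => nnsup setT (fun p =>
      (\int[lebesgue_rV d]_(t in rescaled_set beta c A z p `&`
                                 [set t | (T < weighted_gauge beta t)%R])
         (expR (- (gamma * G p t)))%:E)%E)) +oo
    @[T --> +oo] --> 0%E.

Let lam := lebesgue_rV (R := R) d.
Let E := rescaled_set beta c A.
Let X := rescaled_phase beta c phi mu.
Let Kz := rescaled_kernel K NK mu.
Let w p t := expR (- (gamma * G p t)).
Let Q := \sum_i beta i.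
(* A decay rate for which [eta' * v] dominates [gamma * G] both at [v = G] and
   at any [v >= kappaG * G], and which is still smaller than [eta]. *)
Let eta' := Num.max gamma (gamma / kappaG).

Let Q0 : 0 <= Q.
Proof. by apply: sumr_ge0 => i _; rewrite ltW. Qed.

Let c_gt0 p : 0 < c p.
Proof. by have /andP[h _] := hcbound p; exact: lt_le_trans h. Qed.

Let mG p : measurable_fun setT (G p).
Proof.
exact: (measurableT_comp (f := fun x : P * 'rV[R]_d => G x.1 x.2) hG
  (pair1_measurable p)).
Qed.

Let mw p : measurable_fun setT (w p).
Proof.
apply: measurableT_comp => //; apply: measurableT_comp => //.
exact: measurable_funM.
Qed.

Let w_ge0 p t : 0 <= w p t. Proof. exact: expR_ge0. Qed.

Let w_le1 p t : w p t <= 1.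
Proof. by rewrite -expR0 ler_expR oppr_le0 mulr_ge0// ltW. Qed.

Let mAp p : measurable (A p). Proof. exact: measurable_section hA p. Qed.

Let mAinfp p : measurable (Ainf p). Proof. exact: measurable_section hAinf p. Qed.

Let mE z p : 0 < z -> measurable (E z p).
Proof. by move=> z0; apply: measurable_dilation_image; rewrite ?mulr_gt0. Qed.

Let volA : exists2 V : R, 0 <= V & forall p, (lam (A p) <= V%:E)%E.
Proof.
have [V HV] := lebesgue_rV_bounded hUb.
exists `|V| => // p; apply: le_trans (HV _ (mAp p) (@hAU p)) _.
by rewrite lee_fin ler_norm.
Qed.

Let lamA_lty p : (lam (A p) < +oo)%E.
Proof. by have [V _ HV] := volA; exact: le_lt_trans (HV p) (ltry _). Qed.

(* The masses of all the weighted sets are compared with the mass at a single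
   scale, where boundedness of [U] makes it finite. *)
Lemma weighted_mass_bound : exists2 H : R, 0 <= H &
  (\forall z \near +oo, forall p, (\int[lam]_(t in E z p) (w p t)%:E <= H%:E)%E)
  /\ forall p, (\int[lam]_(t in Ainf p) (w p t)%:E <= H%:E)%E.
Proof.
have [V V0 HV] := volA.
have set1 : \forall z \near +oo, forall p,
    (\int[lam]_t (`|\1_(E z p) t - \1_(Ainf p) t| * w p t)%:E <= 1%:E)%E.
  by move/nnsup_cvg0P : hset => /(_ 1 ltr01); apply: filterS => z Hz p; exact: Hz.
near (+oo : set_system R) => z0.
have z0_gt0 : 0 < z0 by near: z0; exact: nbhs_pinfty_gt.
have setz0 : forall p, (\int[lam]_t
    (`|\1_(E z0 p) t - \1_(Ainf p) t| * w p t)%:E <= 1%:E)%E by near: z0.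
(* At scale [z0], [w <= 1] bounds the mass by the volume of [E z0 p], which is the Jacobian times
   the volume of [A p]. *)
pose H0 : R := (z0 * cplus) `^ Q * V.
have H00 : 0 <= H0 by rewrite mulr_ge0 ?powR_ge0.
have massz0 p : (\int[lam]_(t in E z0 p) (w p t)%:E <= H0%:E)%E.
  have zc0 : 0 < z0 * c p by rewrite mulr_gt0.
  apply: (@le_trans _ _ (\int[lam]_(t in E z0 p) (cst 1 t)))%E.
    apply: ge0_le_integral => //.
    - exact: mE.
    - by move=> t _; rewrite lee_fin.
    - by apply/measurable_EFinP; exact: measurable_funTS.
    - by move=> t _; rewrite lee_fin.
  rewrite (ge0_integral_dilation_image beta zc0 (f := cst 1%E))//.
  rewrite integral_cst// mul1e /H0 EFinM.
  apply: lee_pmul; [by rewrite lee_fin powR_ge0|by []| |exact: HV].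
  have zcp : z0 * c p <= z0 * cplus.
    by rewrite ler_pM2l//; have /andP[] := hcbound p.
  rewrite lee_fin; apply: ge0_ler_powR => //; rewrite nnegrE; first exact: ltW.
  exact: le_trans (ltW zc0) zcp.
have massinf p : (\int[lam]_(t in Ainf p) (w p t)%:E <= (H0 + 1)%:E)%E.
  apply: le_trans (integral_indic_dist lam (mAinfp p) (mE p z0_gt0) (mw p) (w_ge0 p)) _.
  rewrite EFinD leeD//; apply: le_trans (setz0 p).
  by under eq_integral do rewrite distrC.
(* Each [+ 1] pays for one passage across a symmetric difference: from [E z0 p] to [Ainf p], then
   from [Ainf p] to [E z p]. *)
exists (H0 + 1 + 1); first by rewrite !addr_ge0.
split; last first.
  by move=> p; apply: le_trans (massinf p) _; rewrite lee_fin lerDl.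
near=> z => p.
have z_gt0 : 0 < z by near: z; exact: nbhs_pinfty_gt.
apply: le_trans (integral_indic_dist lam (mE p z_gt0) (mAinfp p) (mw p) (w_ge0 p)) _.
rewrite EFinD leeD//.
by move: p; near: z.
Unshelve. all: by end_near. Qed.

Let eta'_lt : eta' < eta.
Proof.
move: hgamma1; rewrite !lt_min => /and3P[_ ek e].
by rewrite /eta' gt_max e ltr_pdivrMr.
Qed.

Let kernel_bound : exists2 C' : R, 0 <= C' &
  (\forall z \near +oo, forall v, 0 <= v ->
     Normc.normc (Kz z v) <= C' * expR (- (eta' * v))) /\
  forall v, 0 <= v -> Normc.normc (Kinf v) <= C' * expR (- (eta' * v)).
Proof.
have [C' C'0 HC] := powR_expR_bound C hr eta'_lt.
have H : \forall z \near +oo, forall v, 0 <= v ->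
     Normc.normc (Kz z v) <= C' * expR (- (eta' * v)).
  apply: filterS hKbound => z Hz v v0.
  by apply: le_trans (Hz v v0) _; exact: HC.
exists C' => //; split => //; exact: locally_uniform_cvg_bound hKlim H.
Qed.

Let expR_phase_le p t x : kappaG * G p t <= x -> expR (- (eta' * x)) <= w p t.
Proof.
move=> Gx; rewrite ler_expR lerN2.
have x0 : 0 <= x by apply: le_trans Gx; rewrite mulr_ge0// ltW.
apply: (@le_trans _ _ (gamma / kappaG * x)).
  by rewrite mulrAC ler_pdivlMr// -mulrA ler_wpM2l ?(ltW hgamma0)// mulrC.
by rewrite ler_wpM2r// le_max lexx orbT.
Qed.

Let expR_homog_le p t : expR (- (eta' * G p t)) <= w p t.
Proof. by rewrite ler_expR lerN2 ler_wpM2r// le_max lexx. Qed.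

(** The normalized integrand in the original variable. At [s = unscale beta c z p t] the argument of
    [Kz z] is [X z p t] by definition. *)
Let f' z p s := b p s * Kz z (z * (phi p s - mu)).

Let KzE z p s : 0 < z -> b p s * K (z * phi p s) = ((NK z)%:C)%C * f' z p s.
Proof.
move=> z0; rewrite /f' /Kz /rescaled_kernel (_ : z * mu + _ = z * phi p s); last by ring.
have NK0 : ((NK z)%:C)%C != 0 by rewrite eq_complex/= eqxx andbT gt_eqF// hNK.
by rewrite mulrCA; congr (_ * _); rewrite [RHS]mulrC divfK.
Qed.

Let mf' z : 0 < z ->
  cmeasurable_fun [set x : P * 'rV[R]_d | A x.1 x.2] (fun x => f' z x.1 x.2).
Proof.
move=> z0; apply: cmeasurable_funM => //; apply: cmeasurable_funM; last first.
  exact: cmeasurable_cst.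
apply: (cmeasurable_comp (E := `[0, +oo[%classic : set R) (f := K)
  (h := fun x : P * 'rV[R]_d => z * mu + z * (phi x.1 x.2 - mu))) => //.
  move=> _ [x Ax <-] /=; rewrite in_itv/= andbT.
  by rewrite addr_ge0// mulr_ge0 ?(ltW z0)// subr_ge0 hphimu.
by apply: measurable_funD => //; apply: measurable_funM => //; exact: measurable_funB.
Qed.

Let phase_ge0 z p s : 0 < z -> A p s -> 0 <= z * (phi p s - mu).
Proof. by move=> z0 As; rewrite mulr_ge0 ?(ltW z0)// subr_ge0 hphimu. Qed.

(** For a fixed [z] it is enough that the integrand is bounded on [A p], whose volume is finite; the
    decay of the kernel matters only after rescaling. *)
Let f'_integrable : \forall z \near +oo, forall p, cintegrable lam (A p) (f' z p).
Proof.
have [C' C'0 [HC _]] := kernel_bound.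
near=> z => p.
have z0 : 0 < z by near: z; exact: nbhs_pinfty_gt.
apply: (cintegrable_bounded (M := M * C')) => //.
  exact: cmeasurable_fun_section hA _ _ (mf' z0).
  exact: lamA_lty.
move=> s As; rewrite Normc.normcM ler_pM ?normc_ge0//; first exact: hbbound.
have Hz : forall v, 0 <= v -> Normc.normc (Kz z v) <= C' * expR (- (eta' * v)).
  by near: z.
apply: le_trans (Hz _ (phase_ge0 z0 As)) _.
rewrite ler_piMr// -expR0 ler_expR oppr_le0 mulr_ge0 ?phase_ge0//.
by rewrite /eta' le_max ltW.
Unshelve. all: by end_near. Qed.

Lemma kernel_integrable : \forall z \near +oo, forall p,
  cintegrable lam (A p) (fun s => b p s * K (z * phi p s)).
Proof.
near=> z => p.
have z0 : 0 < z by near: z; exact: nbhs_pinfty_gt.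
rewrite (_ : (fun _ => _) = fun s => ((NK z)%:C)%C * f' z p s); last first.
  by apply/funext => s; rewrite KzE.
apply: cintegrableZl => //; move: p; near: z; exact: f'_integrable.
Unshelve. all: by end_near. Qed.

Let mKinfG p : cmeasurable_fun setT (fun t => Kinf (G p t)).
Proof.
apply: (cmeasurable_comp (E := `[0, +oo[%classic : set R) (f := Kinf)) => //.
  by move=> _ [t _ <-] /=; rewrite in_itv/= hG0.
exact: within_continuous_cmeasurable.
Qed.

Lemma limit_integrable p : cintegrable lam (Ainf p) (fun t => Kinf (G p t)).
Proof.
have [C' C'0 [_ HC]] := kernel_bound.
have [H H0 [_ HH]] := weighted_mass_bound.
apply: (cintegrable_le (h := fun t => C' * w p t)) => //.
- exact: cmeasurable_funS (mKinfG p).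
- by apply: measurable_funTS; exact: measurable_funM.
- by move=> t _; apply: le_trans (HC _ (hG0 p t)) _; rewrite ler_wpM2l// expR_homog_le.
- under eq_integral do rewrite EFinM.
  rewrite ge0_integralZl//.
  + by rewrite lte_mul_pinfty//; exact: le_lt_trans (HH p) (ltry _).
  + by apply/measurable_EFinP; exact: measurable_funTS.
  + by move=> t _; rewrite lee_fin.
Qed.


Let gplus0 : 0 <= gplus.
Proof. by rewrite -lee_fin; apply: le_trans hGsup; exact: nnsup_ge0. Qed.

Let G_le p t T : 0 <= T -> weighted_gauge beta t <= T -> G p t <= gplus * T.
Proof.
move=> T0; apply: (homogeneous_le_gauge hbeta) => // [s u|s s1]; first exact: hGhom.
rewrite -lee_fin; apply: le_trans hGsup.
exact: (@le_nnsup _ _ _ (fun x => (G x.1 x.2)%:E) (p, s)).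
Qed.

Let E_unscale z p t : 0 < z -> E z p t -> A p (unscale beta c z p t).
Proof. by move=> z0; rewrite /E /rescaled_set dilation_image// mulr_gt0. Qed.

Lemma local_estimate (T e : R) : 0 <= T -> 0 < e ->
  \forall z \near +oo, forall p t, E z p t -> weighted_gauge beta t <= T ->
    Normc.normc (f' z p (unscale beta c z p t) - b0 p * Kinf (G p t)) <= e * w p t.
Proof.
move=> T0 e0.
have [C' C'0 [HC _]] := kernel_bound.
(* On the gauge ball [G <= g], so [w] is at least [expR (- (gamma * g))] there, and an absolute
   error [e'] is at most [e * w]. Half of [e'] goes to the change of [b], half to the change of the
   kernel. *)
pose g := gplus * T.
pose e' := e * expR (- (gamma * g)).
have e'0 : 0 < e' by rewrite mulr_gt0 ?expR_gt0.
have M01 : 0 < `|M0| + 1 by rewrite ltr_wpDl.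
have C1 : 0 < C' + 1 by rewrite ltr_wpDl.
have e10 : 0 < e' / 2 / (`|M0| + 1) by rewrite !divr_gt0.
have [de de0 Hde] := locally_uniform_cvg_segment (g + 1) hKinf hKlim e10.
(* The bound [1] keeps [X] in the segment up to [g + 1], [de / 2] keeps [X] and [G] closer than
   [de], and the last term makes the error of [b] times the kernel bound [C'] at most [e' / 2]. *)
pose e2 := Num.min 1 (Num.min (de / 2) (e' / 2 / (C' + 1))).
have e20 : 0 < e2 by rewrite !lt_min ltr01 !divr_gt0.
have /nnsup_cvg0P/(_ e2 e20) Hl := hlocal T.
near=> z => p t Et tT.
have z0 : 0 < z by near: z; exact: nbhs_pinfty_gt.
have : forall x : P * 'rV[R]_d, E z x.1 x.2 /\ weighted_gauge beta x.2 <= T ->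
    ((Normc.normc (b x.1 (unscale beta c z x.1 x.2) - b0 x.1)
         + `|X z x.1 x.2 - G x.1 x.2|)%:E <= e2%:E)%E by near: z.
move=> /(_ (p, t) (conj Et tT)) /=; rewrite lee_fin => bX.
have b2 : Normc.normc (b p (unscale beta c z p t) - b0 p) <= e2.
  by apply: le_trans bX; rewrite lerDl.
have X2 : `|X z p t - G p t| <= e2.
  by apply: le_trans bX; rewrite lerDr normc_ge0.
have Gg : G p t <= g by exact: G_le.
have X0 : 0 <= X z p t by apply: phase_ge0 => //; exact: E_unscale.
have Xg : X z p t <= g + 1.
  rewrite -(subrK (G p t) (X z p t)) addrC lerD//.
  apply: le_trans (ler_norm _) _; apply: le_trans X2 _.
  by rewrite /e2 ge_min lexx.
have KX : Normc.normc (Kz z (X z p t)) <= C'.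
  have Hz : forall v, 0 <= v -> Normc.normc (Kz z v) <= C' * expR (- (eta' * v)).
    by near: z.
  apply: le_trans (Hz _ X0) _.
  by rewrite ler_piMr// -expR0 ler_expR oppr_le0 mulr_ge0// /eta' le_max ltW.
have KG : Normc.normc (Kz z (X z p t) - Kinf (G p t)) <= e' / 2 / (`|M0| + 1).
  have Hz : forall x y, 0 <= x <= g + 1 -> 0 <= y -> `|x - y| < de ->
    Normc.normc (Kz z x - Kinf y) <= e' / 2 / (`|M0| + 1) by near: z.
  apply: Hz => //; first by rewrite X0.
  apply: le_lt_trans X2 _; rewrite /e2 !gt_min.
  by rewrite [X in _ || (X || _)](_ : _ = true) ?orbT// ltr_pdivrMr// ltr_pMr// ltr1n.
apply: (@le_trans _ _ e'); last first.
  by rewrite ler_wpM2l ?(ltW e0)// ler_expR lerN2 ler_wpM2l// ltW.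
rewrite [leRHS]splitr.
have -> : f' z p (unscale beta c z p t) - b0 p * Kinf (G p t) =
    (b p (unscale beta c z p t) - b0 p) * Kz z (X z p t) +
    b0 p * (Kz z (X z p t) - Kinf (G p t)).
  by rewrite mulrBl mulrBr addrA subrK.
apply: le_trans (ler_normcD _ _) _; rewrite (Normc.normcM (_ - _)).
rewrite (Normc.normcM (b0 p)) lerD//.
  apply: (@le_trans _ _ (e' / 2 / (C' + 1) * C')).
    apply: ler_pM; rewrite ?normc_ge0//; apply: le_trans b2 _.
    by rewrite /e2 !ge_min lexx !orbT.
  by rewrite mulrAC ler_pdivrMr// ler_wpM2l ?lerDl// ltW// divr_gt0.
apply: (@le_trans _ _ (`|M0| * (e' / 2 / (`|M0| + 1)))).
  apply: ler_pM; rewrite ?normc_ge0//; apply: le_trans (hb0bound p) _.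
  exact: ler_norm.
by rewrite mulrA ler_pdivrMr// mulrC ler_wpM2l ?lerDl// ltW// divr_gt0.
Unshelve. all: by end_near. Qed.

(** The limit in [T] is used at a single [T] where the upper limit is strictly below [e]; strictness
    turns it into a bound for all large [z]. *)
Lemma tail_estimate (e : R) : 0 < e -> exists2 T : R, 0 < T &
  \forall z \near +oo, forall p,
    (\int[lam]_(t in E z p `&` [set t | (T < weighted_gauge beta t)%R])
      (w p t)%:E <= e%:E)%E.
Proof.
move=> e0.
pose L (T : R) : \bar R := limf_esup (fun z : R => nnsup setT (fun p =>
    (\int[lam]_(t in E z p `&` [set t | (T < weighted_gauge beta t)%R])
      (w p t)%:E)%E)) +oo%R.
have /fine_cvgP[tfin /cvgrPdist_lt/(_ e e0) tlt] : L T @[T --> +oo] --> 0%E := htail.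
near (+oo : set_system R) => T.
exists T; first by near: T; exact: nbhs_pinfty_gt.
have H : (L T < e%:E)%E.
  have fT : L T \is a fin_num by near: T.
  have lT : `|0 - fine (L T)| < e by near: T.
  rewrite -(fineK fT) lte_fin; apply: le_lt_trans (ler_norm _) _.
  by rewrite -normrN -sub0r.
apply: filterS (limf_esup_lt _ H) => z Hz p.
by apply: le_trans (ltW Hz); exact: le_nnsup.
Unshelve. all: by end_near. Qed.


Lemma uniform_limit (e : R) : 0 < e -> \forall z \near +oo, forall p,
  Normc.normc ((((z * c p) `^ Q / NK z)%:C)%C * kernel_integral A phi b K z p
    - b0 p * cintegral lam (Ainf p) (fun t => Kinf (G p t))) <= e.
Proof.
move=> e0.
have [C' C'0 [HC HCinf]] := kernel_bound.
have [H H0 [HH _]] := weighted_mass_bound.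
(* [M2 * w] dominates the sum of the moduli of the two integrands. With [e1 * H] and [M2 * de] each
   at most [e / 8], twice the integral of the majorant is at most [3 * e / 4]. *)
pose M2 := (`|M| + `|M0|) * C'.
have M20 : 0 <= M2 by rewrite mulr_ge0 ?addr_ge0.
pose e1 := e / 8 / (H + 1).
have H1 : 0 < H + 1 by rewrite ltr_wpDl.
have M21 : 0 < M2 + 1 by rewrite ltr_wpDl.
have e10 : 0 < e1 by rewrite !divr_gt0.
pose de := e / 8 / (M2 + 1).
have de0 : 0 < de by rewrite !divr_gt0.
have [T T0 HT] := tail_estimate de0.
have Hloc := local_estimate (ltW T0) e10.
have /nnsup_cvg0P/(_ de de0) Hset := hset.
near=> z => p.
have z0 : 0 < z by near: z; exact: nbhs_pinfty_gt.
have u0 : 0 < z * c p by rewrite mulr_gt0.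
have fi : cintegrable lam (A p) (f' z p) by move: p {u0}; near: z; exact: f'_integrable.
pose F t := f' z p (unscale beta c z p t).
have Fi : cintegrable lam (E z p) F by exact: cintegrable_dilation_image.
(* The power of [z * c p] is the Jacobian of the dilation, and [NK z] cancels the normalization
   inside [f']. *)
have -> : ((((z * c p) `^ Q / NK z)%:C)%C * kernel_integral A phi b K z p) =
    cintegral lam (E z p) F.
  rewrite (cintegral_dilation_image beta u0 (mAp p) fi) /kernel_integral.
  rewrite (_ : (fun s => _) = fun s => ((NK z)%:C)%C * f' z p s); last first.
    by apply/funext => s; rewrite KzE.
  rewrite cintegralZl// mulrA -rmorphM/= divfK//.
  by rewrite gt_eqF// hNK.
rewrite -cintegralZl//; last exact: limit_integrable.
pose B := [set t : 'rV[R]_d | T < weighted_gauge beta t].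
have mB : measurable B by exact: measurable_weighted_gauge_gt.
have mEB : measurable (E z p `&` B) by apply: measurableI => //; exact: mE.
pose dist t := `|\1_(E z p) t - \1_(Ainf p) t| * w p t : R.
(* The first term covers the common domain with gauge at most [T], the second its part beyond [T],
   and [dist], which equals [w] on the symmetric difference, covers the points in only one
   domain. *)
pose h t := e1 * ((w p) \_ (E z p)) t +
  M2 * (((w p) \_ (E z p `&` B)) t + dist t).
have wr0 (D : set 'rV[R]_d) t : 0 <= ((w p) \_ D) t.
  by rewrite patchE; case: ifP.
have dist0 t : 0 <= dist t by rewrite mulr_ge0.
have mwr (D : set 'rV[R]_d) : measurable D -> measurable_fun setT ((w p) \_ D).
  by move=> mD; exact: (iffLR (measurable_restrictT _ mD) (measurable_funTS (mw p))).
have mdist : measurable_fun setT dist.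
  apply: measurable_funM => //; apply: measurableT_comp => //.
  by apply: measurable_funB; apply: measurable_indic => //; exact: mE.
have e1h t : 0 <= e1 * ((w p) \_ (E z p)) t by exact: mulr_ge0 (ltW e10) (wr0 _ _).
have h0 t : 0 <= h t by rewrite addr_ge0// mulr_ge0 ?addr_ge0.
have inth : (\int[lam]_t (h t)%:E =
    e1%:E * \int[lam]_(t in E z p) (w p t)%:E +
    M2%:E * (\int[lam]_(t in E z p `&` B) (w p t)%:E + \int[lam]_t (dist t)%:E))%E.
  rewrite ge0_integral_lin2//; last 4 first.
  - exact: ltW.
  - exact: (mwr _ (mE p z0)).
  - by apply: measurable_funD => //; exact: mwr.
  - by move=> t; rewrite addr_ge0.
  congr (_ * _ + _ * _)%E.
    by rewrite [RHS]integral_mkcond; apply: eq_integral => t _; rewrite restrict_EFin.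
  under eq_integral do rewrite EFinD.
  rewrite ge0_integralD//.
  - congr (_ + _)%E.
    by rewrite [RHS]integral_mkcond; apply: eq_integral => t _; rewrite restrict_EFin.
  - by move=> t _; rewrite lee_fin.
  - by apply/measurable_EFinP; exact: mwr.
  - by move=> t _; rewrite lee_fin.
  - exact/measurable_EFinP.
have inthe : (2%:E * \int[lam]_t (h t)%:E <= e%:E)%E.
  rewrite inth.
  have I1 : (\int[lam]_(t in E z p) (w p t)%:E <= H%:E)%E by move: (p); near: z.
  have I2 : (\int[lam]_(t in E z p `&` B) (w p t)%:E <= de%:E)%E by move: (p); near: z.
  have I3 : (\int[lam]_t (dist t)%:E <= de%:E)%E.
    have Hz : forall p, [set: P] p -> (\int[lam]_t
      (`|\1_(E z p) t - \1_(Ainf p) t| * w p t)%:E <= de%:E)%E by near: z.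
    exact: Hz.
  apply: (@le_trans _ _ (2%:E * (e1%:E * H%:E + M2%:E * (de%:E + de%:E))))%E.
    rewrite lee_wpmul2l// leeD// lee_wpmul2l ?lee_fin ?(ltW e10)//.
    exact: leeD.
  rewrite -!(EFinM, EFinD) lee_fin.
  have h1 : e1 * H <= e / 8.
    by rewrite /e1 mulrAC ler_pdivrMr// ler_wpM2l ?lerDl// ltW// divr_gt0.
  have h2 : M2 * de <= e / 8.
    by rewrite /de mulrA ler_pdivrMr// mulrC ler_wpM2l ?lerDl// ltW// divr_gt0.
  by rewrite mulrDr; lra.
rewrite -lee_fin; apply: le_trans inthe.
have limi : cintegrable lam (Ainf p) (fun t => b0 p * Kinf (G p t)).
  by apply: cintegrableZl => //; exact: limit_integrable.
have KX t : E z p t -> Normc.normc (F t) <= (`|M| * C') * w p t.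
  move=> Et; have As := E_unscale z0 Et.
  have Hz : forall v, 0 <= v -> Normc.normc (Kz z v) <= C' * expR (- (eta' * v)).
    by near: z.
  have Hco : forall p t, E z p t -> kappaG * G p t <= X z p t by near: z.
  rewrite /F /f' (Normc.normcM (b _ _)) -mulrA ler_pM ?normc_ge0//.
    by apply: le_trans (hbbound As) _; exact: ler_norm.
  apply: le_trans (Hz _ (phase_ge0 z0 As)) _.
  by rewrite ler_wpM2l// expR_phase_le//; exact: Hco.
have KG t : Normc.normc (b0 p * Kinf (G p t)) <= (`|M0| * C') * w p t.
  rewrite (Normc.normcM (b0 p)) -mulrA ler_pM ?normc_ge0//.
    by apply: le_trans (hb0bound p) _; exact: ler_norm.
  by apply: le_trans (HCinf _ (hG0 p t)) _; rewrite ler_wpM2l// expR_homog_le.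
apply: cintegral_dist_le => //.
- exact: mE.
- apply: measurable_funD; apply: measurable_funM => //; first exact: (mwr _ (mE p z0)).
  by apply: measurable_funD => //; exact: mwr.
- move=> t Et Ait; rewrite /h.
  have [tT|tT] := leP (weighted_gauge beta t) T.
    have Hz : forall p t, E z p t -> weighted_gauge beta t <= T ->
      Normc.normc (f' z p (unscale beta c z p t) - b0 p * Kinf (G p t)) <= e1 * w p t.
      by near: z.
    rewrite patchE mem_set//; apply: le_trans (Hz _ _ Et tT) _.
    by rewrite lerDl mulr_ge0 ?addr_ge0.
  apply: le_trans (normcB_le _ _) _; apply: le_trans (lerD (KX _ Et) (KG t)) _.
  rewrite -mulrDl -mulrDl -/M2 -[leLHS]add0r lerD ?e1h//.
  apply: ler_wpM2l => //; rewrite patchE mem_set; last by split.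
  by rewrite lerDl.
- move=> t Et Ait; apply: le_trans (KX _ Et) _.
  rewrite /h -[leLHS]add0r lerD ?e1h//.
  apply: ler_pM => //; rewrite ?mulr_ge0//.
    by rewrite /M2 ler_wpM2r// lerDl.
  by rewrite /dist !indicE mem_set// memNset// subr0 normr1 mul1r lerDr.
- move=> t Et Ait; apply: le_trans (KG t) _.
  rewrite /h -[leLHS]add0r lerD ?e1h//.
  apply: ler_pM => //; rewrite ?mulr_ge0//.
    by rewrite /M2 ler_wpM2r// lerDr.
  by rewrite /dist !indicE memNset// mem_set// sub0r normrN normr1 mul1r lerDr.
Unshelve. all: by end_near. Qed.


(** * Averaging against a finite measure *)

Let J p := cintegral lam (Ainf p) (fun t => Kinf (G p t)).
Let I z p := kernel_integral A phi b K z p.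
Let coef p := ((c p `^ (- Q))%:C)%C * b0 p * J p.

Let J_bound : exists2 B : R, 0 <= B & forall p, Normc.normc (J p) <= B.
Proof.
have [C' C'0 [_ HCinf]] := kernel_bound.
have [H H0 [_ HH]] := weighted_mass_bound.
exists (2 * (C' * H)) => [|p]; first by rewrite !mulr_ge0.
rewrite -lee_fin.
apply: le_trans (normc_cintegral_le (h := fun t => C' * w p t) (mAinfp p)
  (limit_integrable p) _ _) _.
- by apply: measurable_funTS; exact: measurable_funM.
- move=> t _; apply: le_trans (HCinf _ (hG0 p t)) _.
  by rewrite ler_wpM2l// expR_homog_le.
- under eq_integral do rewrite EFinM.
  rewrite ge0_integralZl//.
  + by rewrite !EFinM lee_wpmul2l// lee_wpmul2l//; exact: HH.
  + by apply/measurable_EFinP; exact: measurable_funTS.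
  + by move=> t _; rewrite lee_fin.
Qed.

Let mJ : cmeasurable_fun setT J.
Proof.
rewrite /J; refine (cmeasurable_cintegral_section (m := lam) hAinf
  (f := fun p t => Kinf (G p t)) _ _) => [|p]; last exact: limit_integrable.
apply: (cmeasurable_comp (E := `[0, +oo[%classic : set R) (f := Kinf)
  (h := fun x : P * 'rV[R]_d => G x.1 x.2)) => //.
- by move=> _ [x _ <-] /=; rewrite in_itv/= hG0.
- exact: within_continuous_cmeasurable.
- exact: measurable_funTS.
Qed.

Let mI : \forall z \near +oo, cmeasurable_fun setT (I z).
Proof.
near=> z.
have z0 : 0 < z by near: z; exact: nbhs_pinfty_gt.
refine (cmeasurable_cintegral_section (m := lam) hA
  (f := fun p s => b p s * K (z * phi p s)) _ _); last by near: z; exact: kernel_integrable.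
rewrite (_ : (fun _ => _) = fun x : P * 'rV[R]_d => ((NK z)%:C)%C * f' z x.1 x.2).
  by apply: cmeasurable_funM; [exact: cmeasurable_cst|exact: mf'].
by apply/funext => x; rewrite KzE.
Unshelve. all: by end_near. Qed.

Let mcoef : cmeasurable_fun setT coef.
Proof.
apply: cmeasurable_funM => //; apply: cmeasurable_funM => //.
apply: cmeasurable_real; exact: (measurableT_comp (measurable_powR (- Q)) hc).
Qed.

Let cQ_le p : c p `^ (- Q) <= cminus `^ (- Q).
Proof.
rewrite !powRN lef_pV2 ?posrE ?powR_gt0//.
have /andP[cp _] := hcbound p.
by apply: ge0_ler_powR => //; rewrite nnegrE ltW.
Qed.

Section finite_measure.
Variable nu : {finite_measure set P -> \bar R}.

Let nuT : (nu setT < +oo)%E.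
Proof. by rewrite -ge0_fin_numE//; exact: fin_num_measure. Qed.

Lemma coef_integrable : cintegrable nu setT coef.
Proof.
have [B B0 HB] := J_bound.
apply: (cintegrable_bounded (M := cminus `^ (- Q) * `|M0| * B)) => // p _.
rewrite (Normc.normcM (_ * _)) (Normc.normcM (_%:C)%C).
rewrite normc_real ?powR_ge0//.
rewrite ler_pM ?mulr_ge0 ?powR_ge0 ?normc_ge0//; first last.
rewrite ler_pM ?powR_ge0 ?normc_ge0//.
by apply: le_trans (hb0bound p) _; exact: ler_norm.
Qed.

(** Boundedness in [p] is read off from the uniform limit: the normalized integral is within [1] of
    the bounded limit, and the normalizing factor is smallest at [cminus]. *)
Lemma kernel_integral_integrable : \forall z \near +oo,
  cintegrable nu setT (I z).
Proof.
have [B B0 HB] := J_bound.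
near=> z.
have z0 : 0 < z by near: z; exact: nbhs_pinfty_gt.
have Hz : forall p, Normc.normc ((((z * c p) `^ Q / NK z)%:C)%C * I z p
    - b0 p * J p) <= 1 by near: z; exact: uniform_limit.
have NK0 := hNK z0.
pose a x := (z * x) `^ Q / NK z.
have a0 x : 0 < x -> 0 < a x.
  by move=> x0; apply: divr_gt0 => //; apply: powR_gt0; exact: mulr_gt0.
apply: (cintegrable_bounded (M := (a cminus)^-1 * (`|M0| * B + 1))) => //.
  by near: z; exact: mI.
move=> p _.
have ac : a cminus <= a (c p).
  rewrite /a ler_pM2r ?invr_gt0//; have /andP[cp _] := hcbound p.
  by apply: ge0_ler_powR => //; rewrite ?nnegrE ?mulr_ge0 ?ler_pM2l// ltW.
have -> : Normc.normc (I z p) = (a (c p))^-1 * Normc.normc (((a (c p))%:C)%C * I z p).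
  rewrite Normc.normcM normc_real; last by rewrite ltW// a0.
  by rewrite mulKf// gt_eqF// a0.
rewrite ler_pM ?invr_ge0 ?normc_ge0 ?(ltW (a0 _ _))//.
  by rewrite lef_pV2 ?posrE ?a0.
apply: le_trans (ler_normc_dist _ (b0 p * J p)) _.
rewrite lerD//; last exact: Hz.
rewrite (Normc.normcM (b0 p)) ler_pM ?normc_ge0//.
by apply: le_trans (hb0bound p) _; exact: ler_norm.
Unshelve. all: by end_near. Qed.

Lemma averaged_limit : exists2 e : R -> R[i],
  Normc.normc (e z) @[z --> +oo] --> (0 : R) &
  \forall z \near +oo, cintegral nu setT (I z) =
    ((NK z * z `^ (- Q))%:C)%C * (cintegral nu setT coef + e z).
Proof.
pose k z := NK z * z `^ (- Q).
have k0 z : 0 < z -> 0 < k z by move=> z0; rewrite mulr_gt0 ?hNK// powR_gt0.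
(* The error is defined as the normalized remainder, so the expansion is an identity and only its
   convergence to [0] has content. *)
exists (fun z => (((k z)^-1)%:C)%C * cintegral nu setT (I z) - cintegral nu setT coef).
  apply/cvgrPdist_le => e e0.
  pose N := fine (nu setT).
  have N0 : 0 <= N by exact: fine_ge0.
  have cQ0 : 0 < cminus `^ (- Q) by exact: powR_gt0.
  have cN0 : 0 < cminus `^ (- Q) * (N + 1) by rewrite mulr_gt0// ltr_wpDl.
  (* The [2] compensates the factor of the complex comparison, and [N + 1] replaces the total mass
     [N], which may be [0]. *)
  pose de := e / 2 / (cminus `^ (- Q) * (N + 1)).
  have de0 : 0 < de by rewrite !divr_gt0.
  near=> z.
  have z0 : 0 < z by near: z; exact: nbhs_pinfty_gt.
  have Hz : forall p, Normc.normc ((((z * c p) `^ Q / NK z)%:C)%C * I z p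
    - b0 p * J p) <= de by near: z; exact: uniform_limit.
  have Ii : cintegrable nu setT (I z) by near: z; exact: kernel_integral_integrable.
  rewrite sub0r normrN ger0_norm ?normc_ge0// -cintegralZl//.
  rewrite -lee_fin.
  apply: le_trans (cintegral_dist_le (h := cst (cminus `^ (- Q) * de)) _ _ _
    coef_integrable _ _ _ _ _) _ => //.
  - exact: cintegrableZl.
  - by move=> p; rewrite mulr_ge0// ltW.
  - move=> p _ _.
    (* Pulling out [c p] to the power [- Q], which is bounded by its value at [cminus], leaves
       exactly the quantity controlled by the uniform limit. *)
    have -> : (((k z)^-1)%:C)%C * I z p - coef p = ((c p `^ (- Q))%:C)%C *
        ((((z * c p) `^ Q / NK z)%:C)%C * I z p - b0 p * J p).
      rewrite mulrBr !mulrA -rmorphM/=; congr ((_%:C)%C * _ - _).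
      have cp := c_gt0 p.
      rewrite /k powRM ?(ltW z0) ?(ltW cp)// !powRN.
      have := powR_gt0 Q z0; have := powR_gt0 Q cp; have := hNK z0.
      move=> /lt0r_neq0 n1 /lt0r_neq0 n2 /lt0r_neq0 n3.
      by field; rewrite n1 n2 n3.
    rewrite (Normc.normcM (_%:C)%C) normc_real ?powR_ge0// ler_pM ?powR_ge0 ?normc_ge0//.
  rewrite (_ : \int[nu]_x _ = (cminus `^ (- Q) * de * N)%:E)%E; last first.
    rewrite (integral_cst nu measurableT (cminus `^ (- Q) * de)%:E) [RHS]EFinM /N fineK//.
    exact: fin_num_measure.
  rewrite -EFinM lee_fin /de.
  rewrite [leLHS](_ : _ = e * ((cminus `^ (- Q) * N) / (cminus `^ (- Q) * (N + 1)))).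
    rewrite ler_piMr ?(ltW e0)// ler_pdivrMr// mul1r ler_pM2l//.
    by rewrite lerDl.
  have N1 : N + 1 != 0 by rewrite gt_eqF// ltr_wpDl.
  by field; rewrite N1 (gt_eqF cQ0).
near=> z.
have z0 : 0 < z by near: z; exact: nbhs_pinfty_gt.
rewrite addrC subrK mulrA -rmorphM/= divff ?mul1r//.
by rewrite gt_eqF// k0.
Unshelve. all: by end_near. Qed.

End finite_measure.

End rescaled_kernel_integral.

Theorem theorem3p12 (R : realType)
  (dP : measure_display) (P : measurableType dP)
  (d : nat) (hd : (0 < d)%N)
  (U : set 'rV[R]_d) (hU0 : nbhs (0 : 'rV[R]_d) U) (hUb : bounded_set U)
  (A Ainf : P -> set 'rV[R]_d)
  (hAU : forall p, A p `<=` U)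
  (hA : measurable [set x : P * 'rV[R]_d | A x.1 x.2])
  (hAinf : measurable [set x : P * 'rV[R]_d | Ainf x.1 x.2])
  (beta : 'I_d -> R) (hbeta : forall i, 0 < beta i)
  (c : P -> R) (hc : measurable_fun setT c)
  (cminus cplus : R) (hcminus : 0 < cminus)
  (hcbound : forall p, cminus <= c p <= cplus)
  (G : P -> 'rV[R]_d -> R)
  (hG : measurable_fun setT (fun x : P * 'rV[R]_d => G x.1 x.2))
  (hG0 : forall p t, 0 <= G p t)
  (hGhom : forall p t (u : R), 0 < u -> G p (dilation beta u t) = u * G p t)
  (gplus : R)
  (hGsup : (nnsup [set x : P * 'rV[R]_d | weighted_gauge beta x.2 = 1%R]
              (fun x => (G x.1 x.2)%:E) <= gplus%:E)%E)
  (mu : R) (hmu : 0 <= mu)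
  (phi : P -> 'rV[R]_d -> R) (b : P -> 'rV[R]_d -> R[i])
  (hphi : measurable_fun [set x : P * 'rV[R]_d | A x.1 x.2]
            (fun x => phi x.1 x.2))
  (hb : cmeasurable_fun [set x : P * 'rV[R]_d | A x.1 x.2]
            (fun x => b x.1 x.2))
  (hphimu : forall p s, A p s -> mu <= phi p s)
  (b0 : P -> R[i]) (hb0 : cmeasurable_fun setT b0)
  (hb0bound : exists M : R, forall p, Normc.normc (b0 p) <= M)
  (K : R -> R[i]) (hK : cmeasurable_fun (`[0, +oo[ : set R) K)
  (hbbound : exists M : R, forall p s, A p s -> Normc.normc (b p s) <= M)
  (hlocal : forall T : R,
    nnsup [set x : P * 'rV[R]_d |
            rescaled_set beta c A z x.1 x.2 /\ weighted_gauge beta x.2 <= T]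
      (fun x =>
        (Normc.normc (b x.1 (unscale beta c z x.1 x.2) - b0 x.1)
         + `|rescaled_phase beta c phi mu z x.1 x.2 - G x.1 x.2|)%:E)
      @[z --> +oo] --> 0%E)
  (kappaG : R) (hkappaG : 0 < kappaG)
  (hcoercive : \forall z \near +oo, forall p t, rescaled_set beta c A z p t ->
    kappaG * G p t <= rescaled_phase beta c phi mu z p t)
  (NK : R -> R) (hNK : forall z : R, 0 < z -> 0 < NK z)
  (Kinf : R -> R[i])
  (hKinf : {within `[0, +oo[, continuous (Kinf : R -> R[i]^o)})
  (hKlim : locally_uniform_cvg (rescaled_kernel K NK mu) Kinf)
  (C r eta : R) (hr : 0 <= r) (heta : 0 < eta)
  (hKbound : \forall z \near +oo, forall v, 0 <= v ->
    Normc.normc (rescaled_kernel K NK mu z v)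
      <= C * (1 + v) `^ r * expR (- (eta * v)))
  (gamma : R) (hgamma0 : 0 < gamma)
  (hgamma1 : gamma < Num.min 1 (Num.min (eta * kappaG) eta))
  (hset : nnsup setT (fun p =>
      (\int[lebesgue_rV d]_t
         (`|\1_(rescaled_set beta c A z p) t - \1_(Ainf p) t|
          * expR (- (gamma * G p t)))%:E)%E)
    @[z --> +oo] --> 0%E)
  (htail : limf_esup (fun z : R => nnsup setT (fun p =>
      (\int[lebesgue_rV d]_(t in rescaled_set beta c A z p `&`
                                 [set t | (T < weighted_gauge beta t)%R])
         (expR (- (gamma * G p t)))%:E)%E)) +oo
    @[T --> +oo] --> 0%E) :
  let Q := \sum_i beta i in
  let I := kernel_integral A phi b K in
  let J p := cintegral (lebesgue_rV d) (Ainf p) (fun t => Kinf (G p t)) in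
  let coef p := (c p `^ (- Q))%:C%C * b0 p * J p in
  [/\ \forall z \near +oo, forall p,
        cintegrable (lebesgue_rV d) (A p) (fun s => b p s * K (z * phi p s)),
      forall p,
        cintegrable (lebesgue_rV d) (Ainf p) (fun t => Kinf (G p t)),
      nnsup setT (fun p =>
          (Normc.normc (((z * c p) `^ Q / NK z)%:C%C * I z p
                        - b0 p * J p))%:E)
        @[z --> +oo] --> 0%E
    & forall nu : {finite_measure set P -> \bar R},
        [/\ cintegrable nu setT coef,
            \forall z \near +oo, cintegrable nu setT (I z)
          & exists2 e : R -> R[i],
              Normc.normc (e z) @[z --> +oo] --> (0 : R) &
              \forall z \near +oo,
                cintegral nu setT (I z) =
                (NK z * z `^ (- Q))%:C%C * (cintegral nu setT coef + e z)]].
Proof.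
move=> Q I J coef.
have [M0 hM0] := hb0bound; have [M hM] := hbbound.
split.
- exact: (kernel_integrable hUb hAU hA hmu hphi hb hphimu hK hM hkappaG hNK
    hKlim hr hKbound hgamma0 hgamma1).
- move=> p; exact: (limit_integrable (beta := beta) hUb hAU hA hAinf hbeta
    hcminus hcbound hG hG0 hkappaG hKinf hKlim hr hKbound hgamma0 hgamma1 hset).
- apply/nnsup_cvg0P => e e0.
  have := uniform_limit hUb hAU hA hAinf hbeta hcminus hcbound hG hG0 hGhom
    hGsup hmu hphi hb hphimu hM0 hK hM hlocal hkappaG hcoercive hNK hKinf hKlim
    hr hKbound hgamma0 hgamma1 hset htail e0.
  by apply: filterS => z Hz p _; rewrite lee_fin; exact: Hz.
- move=> nu; split.
  + exact: (coef_integrable hUb hAU hA hAinf hbeta hc hcminus hcbound hG hG0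
      hb0 hM0 hkappaG hKinf hKlim hr hKbound hgamma0 hgamma1 hset nu).
  + exact: (kernel_integral_integrable hUb hAU hA hAinf hbeta hcminus hcbound hG
      hG0 hGhom hGsup hmu hphi hb hphimu hM0 hK hM hlocal hkappaG hcoercive hNK
      hKinf hKlim hr hKbound hgamma0 hgamma1 hset htail nu).
  + exact: (averaged_limit hUb hAU hA hAinf hbeta hc hcminus hcbound hG
      hG0 hGhom hGsup hmu hphi hb hphimu hb0 hM0 hK hM hlocal hkappaG hcoercive
      hNK hKinf hKlim hr hKbound hgamma0 hgamma1 hset htail nu).
Qed.
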